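(* Let $V$ be a finite-dimensional real Euclidean space, let $\Gamma\subset V$ be a dense subgroup which is a free abelian group of finite rank, acting on $V$ by translations, and let $\mathcal W=\{W_1,\dots,W_f\}$ be a finite family of affine hyperplanes of $V$ whose normal vectors span $V$. Put $\mathcal C=\{W+\gamma: W\in\mathcal W,\ \gamma\in\Gamma\}$. Suppose that the number $L_0$ of $\Gamma$-orbits of singular points is finite. Then for every $p$, the rational vector space $H_p(\Gamma, CV_{\mathcal C})\otimes\mathbb Q$ is finite dimensional.
   Context: A singular space (or singular $l$-space) is an affine subspace of $V$ of dimension $l<\dim V$ which is a nonempty intersection of elements of $\mathcal C$; singular points are singular $0$-spaces, and $\Gamma$ acts on singular spaces by translation. A $\mathcal C$-tope is a compact polytope in $V$ which is the closure of its interior and each of whose $(\dim V-1)$-dimensional faces is contained in some element of $\mathcal C$. Let $V'=V\setminus\bigcup_{W\in\mathcal C}W$. $CV_{\mathcal C}$ denotes the ring of integer-valued functions on $V'$ generated (under pointwise addition and multiplication) by the indicator functions of the sets $P\cap V'$, $P$ a $\mathcal C$-tope; it is a $\mathbb Z[\Gamma]$-module via translation. $H_p(\Gamma,\cdot)$ is group homology. *)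

(* Defs.v *)
From HB Require Import structures.
From mathcomp Require Import all_boot all_order all_algebra.
From mathcomp Require Import boolp classical_sets cardinality reals.
Set Implicit Arguments. Unset Strict Implicit. Unset Printing Implicit Defensive.
Import Order.TTheory GRing.Theory Num.Theory.
Local Open Scope ring_scope.
Local Open Scope classical_set_scope.

Section Defs.
Variables (R : realType) (n : nat).
Local Notation V := 'rV[R]_n.

Definition dotv (u v : V) : R := \sum_(i < n) u 0 i * v 0 i.
Definition eball (x : V) (e : R) : set V := [set y | dotv (y - x) (y - x) < e ^+ 2].
Definition interior_e (P : set V) : set V :=
  [set x | exists e, 0 < e /\ eball x e `<=` P].
Definition closure_e (P : set V) : set V :=
  [set x | forall e, 0 < e -> exists y, P y /\ eball x e y].

Definition dense_e (G : set V) : Prop :=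
  forall x e, 0 < e -> exists g, G g /\ eball x e g.

Definition zspan (k : nat) (b : 'I_k -> V) : set V :=
  [set v | exists c : 'I_k -> int, v = \sum_(i < k) b i *~ c i].
Definition free_abelian_finite_rank (G : set V) : Prop :=
  exists (k : nat) (b : 'I_k -> V),
    (forall c : 'I_k -> int, \sum_(i < k) b i *~ c i = 0 -> forall i, c i = 0)
    /\ G = zspan b.

Definition lin_indep (k : nat) (d : 'I_k -> V) : Prop :=
  forall l : 'I_k -> R, \sum_(i < k) l i *: d i = 0 -> forall i, l i = 0.
Definition spans (k : nat) (d : 'I_k -> V) : Prop :=
  forall v : V, exists l : 'I_k -> R, v = \sum_(i < k) l i *: d i.

(** the affine hyperplane {x | <a,x> = c} (an honest hyperplane when a != 0) *)
Definition hyperplane (a : V) (c : R) : set V := [set x | dotv a x = c].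

Definition translate (A : set V) (g : V) : set V := [set x + g | x in A].

Definition Cfam (G : set V) (f : nat) (a : 'I_f -> V) (c : 'I_f -> R) : set (set V) :=
  [set H | exists i g, G g /\ H = translate (hyperplane (a i) (c i)) g].

(** singular points: singular 0-spaces, i.e. points {x} (of dimension 0 < dim V)
    which are an intersection of elements of C *)
Definition singular_point (C : set (set V)) (x : V) : Prop :=
  (0 < n)%N /\ exists S : set (set V), S `<=` C /\ \bigcap_(H in S) H = [set x].

Definition gorbit (G : set V) (x : V) : set V := [set x + g | g in G].

Definition Vprime (C : set (set V)) : set V := ~` (\bigcup_(H in C) H).

Definition conv (k : nat) (p : 'I_k -> V) : set V :=
  [set x | exists l : 'I_k -> R, (forall i, 0 <= l i) /\ \sum_(i < k) l i = 1
                                  /\ x = \sum_(i < k) l i *: p i].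
Definition polytope (P : set V) : Prop := exists (k : nat) (p : 'I_k -> V), P = conv p.

(** F is a (dim V - 1)-dimensional face of P: F = P cut by a supporting
    hyperplane, and F contains an affinely independent family of dim V points *)
Definition codim1_face (P F : set V) : Prop :=
  exists (a : V) (c : R), a != 0 /\ (forall x, P x -> dotv a x <= c)
    /\ F = P `&` hyperplane a c
    /\ exists (x0 : V) (d : 'I_n.-1 -> V),
         F x0 /\ (forall j, F (x0 + d j)) /\ lin_indep d.

Definition Ctope (C : set (set V)) (P : set V) : Prop :=
  polytope P /\ closure_e (interior_e P) = P
  /\ forall F, codim1_face P F -> exists H, C H /\ F `<=` H.

(** CV_C: the ring (under pointwise +, -, * ) generated by the indicator
    functions of P /\ V', P a C-tope.  Integer-valued functions on V' are
    represented as functions V -> int vanishing outside V'. *)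
Inductive CV (C : set (set V)) : (V -> int) -> Prop :=
| CV_gen P : Ctope C P -> CV C (fun x => if `[< (P `&` Vprime C) x >] then 1 else 0)
| CV_zero : CV C (fun _ => 0)
| CV_add f g : CV C f -> CV C g -> CV C (fun x => f x + g x)
| CV_opp f : CV C f -> CV C (fun x => - f x)
| CV_mul f g : CV C f -> CV C g -> CV C (fun x => f x * g x).

Definition tr_act (g : V) (m : V -> int) : V -> int := fun x => m (x - g).

(** Bar complex computing group homology H_p(G, M), G abelian acting on M.
    A p-chain is a finite formal sum of terms m[g_1|...|g_p], encoded as a
    list of pairs ([:: g_1; ...; g_p], m). *)
Definition chain := seq (seq V * (V -> int)).

Definition is_chain (G : set V) (M : (V -> int) -> Prop) (p : nat) (c : chain) : Prop :=
  forall e, e \in c -> [/\ size e.1 = p, (forall g, g \in e.1 -> G g) & M e.2].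

(** value of a chain as a finitely supported function G^p -> M *)
Definition ev (c : chain) (t : seq V) (x : V) : int := \sum_(e <- c | e.1 == t) e.2 x.

Definition bar_face (p i : nat) (e : seq V * (V -> int)) : seq V * (V -> int) :=
  let s := e.1 in let m := e.2 in
  if i == 0%N then (drop 1 s, tr_act (head 0 s) m)
  else if i == p then (take p.-1 s, fun x => (-1) ^+ i * m x)
  else (take i.-1 s ++ (nth 0 s i.-1 + nth 0 s i) :: drop i.+1 s,
        fun x => (-1) ^+ i * m x).

Definition bd (p : nat) (c : chain) : chain :=
  if p is 0 then [::]
  else flatten [seq [seq bar_face p i e | i <- iota 0 p.+1] | e <- c].

Definition is_cycle G M p (z : chain) : Prop :=
  is_chain G M p z /\ ev (bd p z) = (fun _ _ => 0).

(** H_p(G, M) (x)_Z Q is finite dimensional: finitely many homology classes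
    [z_1], ..., [z_k] such that every class has a nonzero integer multiple in
    their Z-span. *)
Definition homology_tensorQ_findim (G : set V) (M : (V -> int) -> Prop) (p : nat) : Prop :=
  exists (k : nat) (zs : 'I_k -> chain), (forall j, is_cycle G M p (zs j)) /\
    forall z, is_cycle G M p z ->
      exists (N : int) (cs : 'I_k -> int) (b : chain),
        N != 0 /\ is_chain G M p.+1 b /\
        forall t x, N * ev z t x = \sum_(j < k) cs j * ev (zs j) t x + ev (bd p.+1 b) t x.

End Defs.

(* Main.v *)
(** CV is a noetherian Z[G]-module, and the homology of G with coefficients in any finitely
    generated Z[G]-module is finitely generated, by noetherianity of Z[G] and dimension shifting.

    A C-tope is a finite intersection of half-spaces bounded by its facets, so CV consists of
    restrictions to V' of functions with bounded support that are integer combinations of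
    cells, i.e. products of indicators of open half-spaces of the family.  A linear relation between
    the normals of a cell expresses it through cells with fewer factors; a cell which cannot be
    reduced further is either invariant under a nonzero translation, or a simplicial cone at a
    singular point.  Up to G there are finitely many such cones, because there are finitely many
    orbits of singular points.  Finally a sum of functions each invariant under a nonzero
    translation is killed by a product of difference operators, which is injective on functions of
    bounded support; hence the latter embed into a quotient of a finitely generated module. *)

(* Noetherianity, rather than finite generation, is carried through the argument for two reasons.
   Dimension shifting replaces a module by the relations between its generators, and these must
   again be finitely generated. Moreover no finite set of generators for the functions of bounded
   support is in sight: cells are often unbounded, so reducing the cells of a bounded function
   leaves the realm of bounded functions and produces cones together with functions that have
   periods. The latter form no evidently finitely generated module, which is why they have to be
   divided out.

   The ring Z[G] is never formed. A module is a subgroup of an ambient abelian group that is stable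
   under a set of additive operators; Hilbert's basis theorem can then adjoin one operator at a
   time, without polynomial or quotient types. The conclusion is reached integrally: the homology
   groups are finitely generated abelian groups, and the passage to Q involves no denominators. *)
Require Import Defs.
From HB Require Import structures.
From mathcomp Require Import all_boot all_order all_algebra.
From mathcomp Require Import boolp classical_sets cardinality functions reals.
From mathcomp Require Import lra zify.
Set Implicit Arguments. Unset Strict Implicit. Unset Printing Implicit Defensive.
Import Order.TTheory GRing.Theory Num.Theory.
Local Open Scope ring_scope.
Local Open Scope classical_set_scope.

(** * Noetherian modules over a family of operators *)

Section Noetherian.
Variable A : zmodType.
Implicit Types (O : set (A -> A)) (N B S : set A).

Definition subgroup N := N 0 /\ forall x y, N x -> N y -> N (x - y).
Definition stable O N := forall t, O t -> forall x, N x -> N (t x).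
Definition submodule O N := subgroup N /\ stable O N.
(** Defined as an intersection, so that [gen_min] serves as the induction principle: to prove a
    property of all of [gen O S], show that it cuts out a submodule containing [S]. With [O] equal
    to [set0] this is the Z-span. *)
Definition gen O S : set A := [set x | forall N, submodule O N -> S `<=` N -> N x].
Definition noetherian O B := forall N, submodule O N -> N `<=` B ->
  exists2 s : seq A, [set` s] `<=` N & N `<=` gen O [set` s].

Lemma subgroup0 N : subgroup N -> N 0. Proof. by case. Qed.
Lemma subgroupB N x y : subgroup N -> N x -> N y -> N (x - y).
Proof. by case=> _; apply. Qed.
Lemma subgroupN N x : subgroup N -> N x -> N (- x).
Proof. by move=> hN Nx; rewrite -sub0r; apply: subgroupB => //; apply: subgroup0. Qed.
Lemma subgroupD N x y : subgroup N -> N x -> N y -> N (x + y).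
Proof. by move=> hN Nx Ny; rewrite -[y]opprK; apply: subgroupB => //; apply: subgroupN. Qed.
Lemma subgroup_sum N (I : Type) (r : seq I) (P : pred I) (F : I -> A) :
  subgroup N -> (forall i, P i -> N (F i)) -> N (\sum_(i <- r | P i) F i).
Proof.
by move=> hN hF; elim/big_rec: _ => [|i x Pi Nx]; [exact: subgroup0|apply: subgroupD => //; apply: hF].
Qed.
Lemma subgroupMn N x n : subgroup N -> N x -> N (x *+ n).
Proof.
move=> hN Nx; elim: n => [|n IH]; first by rewrite mulr0n; apply: subgroup0.
by rewrite mulrS; apply: subgroupD.
Qed.
Lemma subgroupMz N x z : subgroup N -> N x -> N (x *~ z).
Proof.
move=> hN Nx; case: z => n; first by rewrite -pmulrn; apply: subgroupMn.
by rewrite NegzE mulrNz; apply: subgroupN => //; apply: subgroupMn.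
Qed.

Lemma gen_submodule O S : submodule O (gen O S).
Proof.
split; first split.
- by move=> N [hN _] _; apply: subgroup0.
- by move=> x y hx hy N hN hS; apply: subgroupB; [case: hN|apply: hx|apply: hy].
- by move=> t Ot x hx N hN hS; apply: hN.2 => //; apply: hx.
Qed.
Lemma sub_gen O S : S `<=` gen O S. Proof. by move=> x Sx N _; apply. Qed.
Lemma gen_min O S N : submodule O N -> S `<=` N -> gen O S `<=` N.
Proof. by move=> hN hS x; apply. Qed.
Lemma gen_mono O S S' : S `<=` S' -> gen O S `<=` gen O S'.
Proof. by move=> h x hx N hN hS; apply: hx => // y /h /hS. Qed.
Lemma gen_ops O O' S : O `<=` O' -> gen O S `<=` gen O' S.
Proof.
move=> h x hx N hN hS; apply: hx => //; split; first by case: hN.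
by move=> t /h Ot; apply: hN.2.
Qed.

Lemma noetherian_sub O B B' : B `<=` B' -> noetherian O B' -> noetherian O B.
Proof. by move=> h hB N hN hNB; apply: hB => // x /hNB /h. Qed.

Definition sumset B1 B2 : set A := [set x | exists b1 b2, [/\ B1 b1, B2 b2 & x = b1 + b2]].

Definition addops O := forall t, O t -> forall x y, t (x - y) = t x - t y.

Lemma sumset_submodule O B1 B2 : addops O ->
  submodule O B1 -> submodule O B2 -> submodule O (sumset B1 B2).
Proof.
move=> addO h1 h2; split; first split.
- by exists 0, 0; rewrite addr0; split => //; apply: subgroup0; [case: h1|case: h2].
- move=> _ _ [x1 [x2 [hx1 hx2 ->]]] [y1 [y2 [hy1 hy2 ->]]].
  exists (x1 - y1), (x2 - y2); split; last by rewrite opprD addrACA.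
    by apply: subgroupB => //; case: h1.
  by apply: subgroupB => //; case: h2.
- move=> t Ot _ [x1 [x2 [hx1 hx2 ->]]]; exists (t x1), (t x2); split.
  + exact: h1.2.
  + exact: h2.2.
  + rewrite -[x2 in LHS]opprK addO // -[in LHS](sub0r x2) addO //.
    by have := addO _ Ot 0 0; rewrite !subrr => ->; rewrite sub0r opprK.
Qed.

Lemma addops0 O t : addops O -> O t -> t 0 = 0.
Proof. by move=> addO Ot; have := addO _ Ot 0 0; rewrite !subrr. Qed.
Lemma addopsN O t x : addops O -> O t -> t (- x) = - t x.
Proof. by move=> addO Ot; rewrite -[LHS]/(t (- x)) -sub0r addO // (addops0 addO Ot) sub0r. Qed.
Lemma addopsD O t x y : addops O -> O t -> t (x + y) = t x + t y.
Proof. by move=> addO Ot; rewrite -{1}[y]opprK addO // (addopsN _ addO Ot) opprK. Qed.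

(** Finite choice, used to lift a finite list of generators through a quotient or a boundary map.
    The second clause keeps the lifts free of foreign elements. *)
Lemma lift_seq (T T' : choiceType) (rel : T -> T' -> Prop) (s : seq T) :
  (forall x, x \in s -> exists y, rel x y) ->
  exists s' : seq T', (forall x, x \in s -> exists2 y, y \in s' & rel x y) /\
    (forall y, y \in s' -> exists2 x, x \in s & rel x y).
Proof.
elim: s => [|x s IH] h; first by exists [::].
have [|s' [h1 h2]] := IH; first by move=> y ys; apply: h; rewrite inE ys orbT.
have [y xy] := h x (mem_head _ _); exists (y :: s'); split=> z.
  rewrite inE => /orP[/eqP ->|/h1 [w ws zw]]; first by exists y; rewrite ?mem_head.
  by exists w => //; rewrite inE ws orbT.
rewrite inE => /orP[/eqP ->|/h2 [w ws zw]]; first by exists x; rewrite ?mem_head.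
by exists w => //; rewrite inE ws orbT.
Qed.

(** The extension argument: generators of the image of [N] modulo [B2], lifted to [N], together with
    generators of the part of [N] inside [B2], generate [N]. *)
Lemma noetherian_sum O B1 B2 : addops O -> submodule O B1 -> submodule O B2 ->
  noetherian O B1 -> noetherian O B2 -> noetherian O (sumset B1 B2).
Proof.
move=> addO h1 h2 n1 n2 N hN NB.
(* [N1] consists of the representatives in [B1] of the image of [N] modulo [B2]. *)
pose N1 := [set b | B1 b /\ exists2 b2, B2 b2 & N (b + b2)].
have hN1 : submodule O N1.
  split; first split.
  - by split; [apply: subgroup0; case: h1|exists 0; rewrite ?addr0; apply: subgroup0; [case: h2|case: hN]].
  - move=> x y [Bx [x2 Bx2 Nx]] [By [y2 By2 Ny]]; split; first by apply: subgroupB => //; case: h1.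
    exists (x2 - y2); first by apply: subgroupB => //; case: h2.
    by rewrite addrACA -opprD; apply: subgroupB => //; case: hN.
  - move=> t Ot x [Bx [x2 Bx2 Nx]]; split; first exact: h1.2.
    by exists (t x2); [exact: h2.2|rewrite -(addopsD _ _ addO Ot); apply: hN.2].
have [|s1 s1N N1s] := n1 N1 hN1; first by move=> x [].
have hN2 : submodule O (N `&` B2).
  split; first split.
  - by split; apply: subgroup0; [case: hN|case: h2].
  - by move=> x y [Nx Bx] [Ny By]; split; apply: subgroupB => //; [case: hN|case: h2].
  - by move=> t Ot x [Nx Bx]; split; [apply: hN.2|apply: h2.2].
have [|s2 s2N N2s] := n2 _ hN2; first by move=> x [].
pose rel x y := N y /\ B2 (y - x).
have [|s1' [r1 r2]] := @lift_seq _ _ rel s1.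
  move=> x /s1N [Bx [x2 Bx2 Nx]]; exists (x + x2); split => //.
  by rewrite addrC addKr.
exists (s1' ++ s2).
  move=> x /=; rewrite mem_cat => /orP[/r2 [y _ []]//|/s2N[]//].
move=> x Nx; have [b1 [b2 [Bb1 Bb2 xE]]] := NB _ Nx.
set X := gen _ _; have hX : submodule O X by exact: gen_submodule.
(* The elements of [B1] congruent modulo [B2] to an element of [X] and [N]. This submodule contains
   [s1], hence all of [N1]. *)
pose Q := [set b | B1 b /\ exists2 y, X y /\ N y & B2 (y - b)].
have hQ : submodule O Q.
  split; first split.
  - split; first by apply: subgroup0; case: h1.
    exists 0; last by rewrite subr0; exact: subgroup0 h2.1.
    by split; [exact: subgroup0 hX.1|exact: subgroup0 hN.1].
  - move=> y z [By [y' [Xy Ny] By']] [Bz [z' [Xz Nz] Bz']].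
    split; first exact: subgroupB h1.1 By Bz.
    exists (y' - z'); first by split; [exact: subgroupB hX.1 Xy Xz|exact: subgroupB hN.1 Ny Nz].
    rewrite opprD addrACA -opprD.
    by apply: subgroupB => //; case: h2.
  - move=> t Ot y [By [y' [Xy Ny] By']]; split; first exact: h1.2.
    by exists (t y'); [split; [apply: hX.2|apply: hN.2]|rewrite -addO //; apply: h2.2].
have sQ : [set` s1] `<=` Q.
  move=> y ys; split; first by case: (s1N _ ys).
  have [z zs [Nz Bz]] := r1 _ ys; exists z => //; split => //.
  by apply: sub_gen => /=; rewrite mem_cat zs.
have [_ [y [Xy Ny] By]] : Q b1.
  apply: (gen_min hQ sQ); apply: N1s; split => //; exists b2 => //; by rewrite -xE.
have Xxy : X (x - y).
  apply: (@gen_mono O [set` s2]); first by move=> z /= zs; rewrite mem_cat zs orbT.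
  apply: N2s; split; first exact: subgroupB hN.1 Nx Ny.
  have -> : x - y = b2 - (y - b1) by rewrite xE opprB addrA [b2 + b1]addrC.
  exact: subgroupB h2.1 Bb2 By.
by rewrite -[x](subrK y); exact: subgroupD hX.1 Xxy Xy.
Qed.

(* Hilbert's basis theorem for modules: adjoin one more commuting operator [t] to the operators [O].
   The role of the polynomials of degree < d is played by [polys d]. *)
Section Adjoin.
Variables (O : set (A -> A)) (t : A -> A) (B : set A).
Let O' := O `|` [set t].
Hypothesis addO : addops O'.
Hypothesis comm : forall o, O o -> forall x, o (t x) = t (o x).
Hypothesis hB : submodule O B.

Fixpoint polys d : set A :=
  if d is d'.+1 then [set x | exists b u, [/\ B b, polys d' u & x = iter d' t b + u]]
  else [set 0].

Let addOO : addops O. Proof. by move=> o Oo; apply: addO; left. Qed.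
Let Ot : O' t. Proof. by right. Qed.

Lemma iter_subr d x y : iter d t (x - y) = iter d t x - iter d t y.
Proof. by elim: d => //= d ->; rewrite addO. Qed.
Lemma iter_0 d : iter d t 0 = 0.
Proof. by elim: d => //= d ->; rewrite (addops0 addO). Qed.
Lemma iter_comm o d x : O o -> o (iter d t x) = iter d t (o x).
Proof. by move=> Oo; elim: d => //= d IH; rewrite comm // IH. Qed.

Lemma polys_submodule d : submodule O (polys d).
Proof.
elim: d => [|d IH]; split; try split => //=.
- by move=> x y /= -> ->; rewrite subrr.
- by move=> o Oo x /= ->; apply: addops0 Oo.
- by exists 0, 0; rewrite iter_0 addr0; split => //; [exact: subgroup0 hB.1|exact: subgroup0 IH.1].
- move=> _ _ [b [u [Bb Uu ->]]] [c [v [Bc Uv ->]]]; exists (b - c), (u - v); split.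
  + exact: subgroupB hB.1 Bb Bc.
  + exact: subgroupB IH.1 Uu Uv.
  + by rewrite iter_subr opprD addrACA.
- move=> o Oo _ [b [u [Bb Uu ->]]]; exists (o b), (o u); split.
  + exact: hB.2.
  + exact: IH.2.
  + by rewrite (addopsD _ _ addOO Oo) iter_comm.
Qed.

Lemma polysS d x : polys d x -> polys d.+1 x.
Proof. by move=> Ux; exists 0, x; rewrite iter_0 add0r; split => //; exact: subgroup0 hB.1. Qed.
Lemma polys_le d e x : (d <= e)%N -> polys d x -> polys e x.
Proof.
move=> le Ux; rewrite -(subnK le); elim: (e - d)%N => [//|k IH].
by rewrite addSn; apply: polysS.
Qed.
Lemma polys_t d x : polys d x -> polys d.+1 (t x).
Proof.
elim: d x => [x Ux|d IH x [b [u [Bb Uu ->]]]].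
  have -> : x = 0 := Ux.
  by rewrite (addops0 addO Ot); apply: (@polysS 0).
by exists b, (t u); split => //; [exact: IH|rewrite (addopsD _ _ addO Ot)].
Qed.
Lemma polys_iter d k x : polys d x -> polys (k + d) (iter k t x).
Proof. by move=> Ux; elim: k => //= k IH; apply: polys_t. Qed.

Lemma gen_polys x : gen O' B x -> exists d, polys d x.
Proof.
apply: (@gen_min _ _ [set x | exists d, polys d x]); last first.
  move=> b Bb; exists 1%N; exists b, 0; rewrite addr0; split => //.
split; first split.
- by exists 0%N.
- move=> y z [d Uy] [e Uz]; exists (maxn d e); apply: subgroupB (polys_submodule _).1 _ _.
    by apply: polys_le Uy; rewrite leq_maxl.
  by apply: polys_le Uz; rewrite leq_maxr.
- move=> o [Oo|->] y [d Uy]; first by exists d; apply: (polys_submodule d).2.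
  by exists d.+1; apply: polys_t.
Qed.

Section Leading.
Variable N : set A.
Hypothesis hN : submodule O' N.

(** An element of [A] does not determine the coefficients of an expression for it as a polynomial in
    [t], so this collects every [b] that occurs as the coefficient of [t]^d in some expression of
    some element of [N]. Hilbert's argument works with this weaker notion. *)
Definition leading d : set A := [set b | B b /\ exists2 u, polys d u & N (iter d t b + u)].

Lemma leading_submodule d : submodule O (leading d).
Proof.
have hU := polys_submodule d; split; first split.
- split; first exact: subgroup0 hB.1.
  by exists 0; rewrite ?iter_0 ?addr0; [exact: subgroup0 hU.1|exact: subgroup0 hN.1].
- move=> x y [Bx [u Uu Nu]] [By [v Uv Nv]]; split; first exact: subgroupB hB.1 Bx By.
  exists (u - v); first exact: subgroupB hU.1 Uu Uv.
  by rewrite iter_subr addrACA -opprD; exact: subgroupB hN.1 Nu Nv.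
- move=> o Oo x [Bx [u Uu Nu]]; split; first exact: hB.2.
  exists (o u); first exact: hU.2.
  by rewrite -iter_comm // -(addopsD _ _ addOO Oo); apply: hN.2 => //; left.
Qed.

Lemma leading_le d e : (d <= e)%N -> leading d `<=` leading e.
Proof.
move=> le b Lb; rewrite -(subnK le); elim: (e - d)%N => [//|k [Bb [u Uu Nu]]].
rewrite addSn; split => //; exists (t u); first exact: polys_t.
by rewrite /= -(addopsD _ _ addO Ot); apply: hN.2.
Qed.

Hypothesis nB : noetherian O B.

(** The union of this ascending chain is a submodule of [B], so it has finitely many generators, and
    these all lie in one member of the chain. *)
Lemma leading_stationary : exists D, forall d, leading d `<=` leading D.
Proof.
pose Linf := [set b | exists d, leading d b].
have [|b [d []]//|s sL Ls] := nB (N := Linf).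
  split; first split.
  - by exists 0%N; exact: subgroup0 (leading_submodule 0).1.
  - move=> x y [d Lx] [e Ly]; exists (maxn d e); apply: subgroupB (leading_submodule _).1 _ _.
      by apply: leading_le Lx; rewrite leq_maxl.
    by apply: leading_le Ly; rewrite leq_maxr.
  - by move=> o Oo x [d Lx]; exists d; apply: (leading_submodule d).2.
have [D hD] : exists D, [set` s] `<=` leading D.
  elim: (s) sL => [|x r IH] sL; first by exists 0%N.
  have [|D hD] := IH; first by move=> y ys; apply: sL => /=; rewrite inE (ys : y \in r) orbT.
  have [|d Lx] := sL x; first by rewrite /= mem_head.
  exists (maxn d D) => y /=; rewrite inE => /orP[/eqP ->|yr].
    by apply: leading_le Lx; rewrite leq_maxl.
  by apply: (@leading_le D) (hD _ yr); rewrite leq_maxr.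
exists D => d b Lb; apply: (gen_min (leading_submodule D) hD); apply: Ls; by exists d.
Qed.

(** One finite list realises the leading coefficients in all degrees below [D]: for each degree,
    lift finitely many generators of [leading d] to elements of [N]. *)
Lemma leading_lift D : exists2 X : seq A, [set` X] `<=` N &
  forall d, (d < D)%N -> forall b, leading d b ->
    exists y u, [/\ gen O' [set` X] y, N y, polys d u & y = iter d t b + u].
Proof.
elim: D => [|D [X XN hX]]; first by exists [::].
have [|s sL Ls] := nB (leading_submodule D); first by move=> b [].
pose rel b y := N y /\ exists2 u, polys D u & y = iter D t b + u.
have [|X' [r1 r2]] := @lift_seq _ _ rel s.
  by move=> b /sL[Bb [u Uu Nu]]; exists (iter D t b + u); split => //; exists u.
exists (X ++ X').
  by move=> x /=; rewrite mem_cat => /orP[/XN//|/r2[y _ []]].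
set Y := gen _ _; have hY : submodule O' Y by exact: gen_submodule.
have YX x : gen O' [set` X] x -> Y x.
  by apply: gen_mono => y /= yX; rewrite mem_cat (yX : y \in X).
move=> d; rewrite ltnS leq_eqVlt => /orP[/eqP ->|ltD] b Lb; last first.
  by have [y [u [Xy Ny Uu yE]]] := hX d ltD b Lb; exists y, u; split => //; apply: YX.
have hU := polys_submodule D.
pose Q := [set b | exists y u, [/\ Y y, N y, polys D u & y = iter D t b + u]].
have hQ : submodule O Q.
  split; first split.
  - by exists 0, 0; rewrite iter_0 addr0; split => //;
      [exact: subgroup0 hY.1|exact: subgroup0 hN.1|exact: subgroup0 hU.1].
  - move=> x z [y [u [Yy Ny Uu yE]]] [y' [u' [Yy' Ny' Uu' yE']]].
    exists (y - y'), (u - u'); split.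
    + exact: subgroupB hY.1 Yy Yy'.
    + exact: subgroupB hN.1 Ny Ny'.
    + exact: subgroupB hU.1 Uu Uu'.
    + by rewrite yE yE' iter_subr opprD addrACA.
  - move=> o Oo x [y [u [Yy Ny Uu yE]]]; exists (o y), (o u); split.
    + by apply: hY.2 => //; left.
    + by apply: hN.2 => //; left.
    + exact: hU.2.
    + by rewrite yE (addopsD _ _ addOO Oo) iter_comm.
apply: (gen_min hQ _ (Ls _ Lb)) => c cs.
have [y yX' [Ny [u Uu yE]]] := r1 _ cs; exists y, u; split => //.
by apply: sub_gen; rewrite /= mem_cat yX' orbT.
Qed.

End Leading.

Lemma noetherian_adjoin : noetherian O B -> noetherian O' (gen O' B).
Proof.
move=> nB N hN NB; have [D hD] := leading_stationary hN nB.
have [X XN hX] := leading_lift hN nB D.+1; exists X => // x Nx.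
set Y := gen _ _; have hY : submodule O' Y by exact: gen_submodule.
have iterY k y : Y y /\ N y -> Y (iter k t y) /\ N (iter k t y).
  by elim: k => //= k IH /IH [??]; split; [apply: hY.2|apply: hN.2].
have [d] := gen_polys (NB _ Nx); elim: d x Nx => [x _ ->|d IH x Nx [b [u [Bb Uu xE]]]].
  exact: subgroup0 hY.1.
have Lb : leading N d b by split => //; exists u; rewrite -?xE.
(* An element of [N] and [Y] with the same top term as [x]. Up to degree [D] it comes from the list;
   beyond, an element for degree [D] is multiplied by [t]^(d - D). Subtracting it lowers the
   degree. *)
have [y [Yy Ny] [v Uv yE]] : exists2 y, Y y /\ N y & exists2 v, polys d v & y = iter d t b + v.
  have [led|ltD] := leqP d D.
    by have [y [v [Yy Ny Uv yE]]] := hX d led b Lb; exists y => //; exists v.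
  have [y [v [Yy Ny Uv yE]]] := hX D (ltnSn D) b (hD _ _ Lb).
  exists (iter (d - D) t y); first exact: iterY.
  exists (iter (d - D) t v); first by rewrite -{1}(subnK (ltnW ltD)); exact: polys_iter.
  rewrite yE -{2}(subnK (ltnW ltD)) iterD -[v in LHS]opprK iter_subr.
  by rewrite -[in LHS](sub0r v) iter_subr iter_0 sub0r opprK.
rewrite -[x](subrK y); apply: subgroupD hY.1 _ Yy; apply: IH.
  exact: subgroupB hN.1 Nx Ny.
by rewrite xE yE opprD addrACA subrr add0r; exact: subgroupB (polys_submodule d).1 Uu Uv.
Qed.

End Adjoin.

Definition multiples (x : A) : set A := [set x *~ z | z in [set: int]].

Lemma multiples_submodule x : submodule set0 (multiples x).
Proof.
split=> //; split; first by exists 0; rewrite ?mulr0z.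
by move=> _ _ [y _ <-] [z _ <-]; exists (y - z); rewrite ?mulrzBr.
Qed.

(** Division with remainder by the least positive multiple of [x] that lies in [N]. If there is
    none, [N] is zero; an [x] of finite order falls under the first case, because 0 lies in [N]. *)
Lemma noetherian_multiples x : noetherian set0 (multiples x).
Proof.
move=> N [hN _] NB.
have [exk|nok] := pselect (exists k : nat, N (x *+ k.+1)).
  have exk' : exists k : nat, `[< N (x *+ k.+1) >] by case: exk => k; exists k; apply/asboolP.
  case: (ex_minnP exk') => k /asboolP Nk mink.
  exists [:: x *+ k.+1]; first by move=> y /=; rewrite inE => /eqP ->.
  move=> y Ny; have [z _ yE] := NB _ Ny.
  have Nr : N (x *~ (z %% k.+1)%Z).
    have -> : x *~ (z %% k.+1)%Z = y - (x *+ k.+1) *~ (z %/ k.+1)%Z.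
      rewrite -yE pmulrn -mulrzA -mulrzBr; congr (_ *~ _).
      by rewrite [X in _ = X - _](divz_eq z k.+1) mulrC addrAC subrr add0r.
    exact: subgroupB hN Ny (subgroupMz _ hN Nk).
  have r0 : (z %% k.+1)%Z = 0.
    have := ltz_pmod z (isT : 0 < k.+1%:Z); have := modz_ge0 z (isT : k.+1%:Z != 0).
    case: (z %% k.+1)%Z Nr => // [[|r]] // Nr _.
    rewrite ltz_nat ltnS => ltr; have := mink r (asboolT Nr).
    by rewrite leqNgt ltr.
  rewrite -yE (divz_eq z k.+1) r0 addr0 mulrC mulrzA -pmulrn.
  apply: (subgroupMz _ (gen_submodule _ _).1).
  by apply: sub_gen; rewrite /= mem_head.
exists [::] => // y Ny; have [z _ yE] := NB _ Ny.
suff -> : y = 0 by exact: subgroup0 (gen_submodule _ _).1.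
move: yE Ny => <-; case: z => [[|k]|k]; rewrite ?mulr0z // => Nk; case: nok; exists k => //.
by rewrite NegzE mulrNz in Nk; rewrite -[_ *+ _]opprK; exact: subgroupN hN Nk.
Qed.

Lemma noetherian_span (s : seq A) : noetherian set0 (gen set0 [set` s]).
Proof.
have add0 : addops set0 by [].
elim: s => [|x s IH].
  by move=> N hN NB; exists [::].
have hs := gen_submodule set0 [set` s]; have hx := multiples_submodule x.
apply: noetherian_sub (noetherian_sum add0 hx hs (@noetherian_multiples x) IH).
apply: gen_min; first exact: sumset_submodule.
move=> y /=; rewrite inE => /orP[/eqP ->|ys].
  by exists x, 0; rewrite addr0; split => //; [exists 1|exact: subgroup0 hs.1].
exists 0, y; rewrite add0r; split => //; [exact: subgroup0 hx.1|exact: sub_gen].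
Qed.

(* [C] embeds into [(B + L) / L], a quotient of [B]. *)
Lemma noetherian_transfer O B C L : addops O -> submodule O B -> submodule O C ->
  submodule O L -> C `<=` sumset B L -> (forall x, C x -> L x -> x = 0) ->
  noetherian O B -> noetherian O C.
Proof.
move=> addO hB hC hL CBL CL nB N hN NC.
pose rel (b x : A) := N x /\ L (b - x).
pose K := [set b | B b /\ exists x, rel b x].
have hK : submodule O K.
  split; first split.
  - split; first exact: subgroup0 hB.1.
    by exists 0; split; [exact: subgroup0 hN.1|rewrite subr0; exact: subgroup0 hL.1].
  - move=> b c [Bb [x [Nx Lx]]] [Bc [y [Ny Ly]]]; split; first exact: subgroupB hB.1 Bb Bc.
    exists (x - y); split; first exact: subgroupB hN.1 Nx Ny.
    by rewrite opprD addrACA -opprD; exact: subgroupB hL.1 Lx Ly.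
  - move=> o Oo b [Bb [x [Nx Lx]]]; split; first exact: hB.2.
    by exists (o x); split; [exact: hN.2|rewrite -addO //; exact: hL.2].
have [|s sK Ks] := nB K hK; first by move=> b [].
have [|s' [r1 r2]] := @lift_seq _ _ rel s; first by move=> b /sK[].
exists s'; first by move=> x /r2[b _ []].
move=> x Nx; have [b [l [Bb Ll xE]]] := CBL _ (NC _ Nx).
set Y := gen _ _; have hY : submodule O Y by exact: gen_submodule.
have YN : Y `<=` N by apply: gen_min => // y /r2[? _ []].
pose Q := [set b | exists2 y, Y y & L (b - y)].
have hQ : submodule O Q.
  split; first split.
  - by exists 0; [exact: subgroup0 hY.1|rewrite subr0; exact: subgroup0 hL.1].
  - move=> c d [y Yy Ly] [z Yz Lz]; exists (y - z); first exact: subgroupB hY.1 Yy Yz.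
    by rewrite opprD addrACA -opprD; exact: subgroupB hL.1 Ly Lz.
  - move=> o Oo c [y Yy Ly]; exists (o y); first exact: hY.2.
    by rewrite -addO //; exact: hL.2.
have [y Yy Ly] : Q b.
  apply: (gen_min hQ _ (Ks b _)).
    by move=> c cs; have [y ys [_ Ly]] := r1 _ cs; exists y => //; exact: sub_gen.
  split=> //; exists x; split => //.
  by rewrite xE opprD addrA subrr add0r; exact: subgroupN hL.1 Ll.
suff -> : x = y by [].
apply/eqP; rewrite -subr_eq0; apply/eqP; apply: CL.
  by apply: subgroupB hC.1 _ _; apply: NC => //; apply: YN.
by rewrite xE addrAC; exact: subgroupD hL.1 Ly Ll.
Qed.

End Noetherian.

Lemma noetherian_image (A A' : zmodType) (O : set (A -> A)) (O' : set (A' -> A'))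
    (h : A -> A') (B : set A) :
  (forall x y, h (x - y) = h x - h y) ->
  (forall o, O o -> exists2 o', O' o' & forall x, h (o x) = o' (h x)) ->
  submodule O B -> noetherian O B -> noetherian O' (h @` B).
Proof.
move=> hB hO sB nB N hN NB.
have h0 : h 0 = 0 by rewrite -(subrr 0) hB subrr.
pose K := B `&` (h @^-1` N).
have hK : submodule O K.
  split; first split.
  - by split; rewrite /= ?h0; [exact: subgroup0 sB.1|exact: subgroup0 hN.1].
  - move=> x y [Bx Nx] [By Ny]; split; first exact: subgroupB sB.1 Bx By.
    by rewrite /= hB; exact: subgroupB hN.1 Nx Ny.
  - move=> o Oo x [Bx Nx]; split; first exact: sB.2.
    by have [o' Oo' /= ->] := hO _ Oo; apply: hN.2.
have [|s sK Ks] := nB K hK; first by move=> x [].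
exists [seq h x | x <- s]; first by move=> _ /mapP[x /sK[_ Nx] ->].
move=> y Ny; have [x Bx xy] := NB _ Ny; rewrite -xy in Ny *.
set Y := gen _ _; have hY : submodule O' Y by exact: gen_submodule.
apply: (@gen_min _ O [set` s] (h @^-1` Y)); last exact: Ks.
  split; first split.
  - by rewrite /= h0; exact: subgroup0 hY.1.
  - by move=> u v /= Yu Yv; rewrite hB; exact: subgroupB hY.1 Yu Yv.
  - by move=> o Oo u /= Yu; have [o' Oo' ->] := hO _ Oo; apply: hY.2.
by move=> z zs /=; apply: sub_gen; rewrite /= map_f.
Qed.

(** * Modules over finitely generated abelian groups *)

Section Action.
Variables (V A : zmodType).

Record is_action (act : V -> A -> A) : Prop := IsAction {
  actB : forall g x y, act g (x - y) = act g x - act g y;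
  act0 : forall x, act 0 x = x;
  actD : forall g h x, act (g + h) x = act g (act h x) }.

Variable act : V -> A -> A.
Hypothesis hact : is_action act.

Definition action_ops (G : set V) : set (A -> A) := [set act g | g in G].

Lemma action_addops G : addops (action_ops G).
Proof. by move=> _ [g _ <-] x y; apply: actB. Qed.

Lemma action_comm g h x : act g (act h x) = act h (act g x).
Proof. by rewrite -!(actD hact) addrC. Qed.

(** The basis theorem is applied once per element of [l], starting from the Z-span of [s]. The
    operators commute because the acting group is abelian. *)
Lemma noetherian_action_seq (l : seq V) (s : seq A) :
  noetherian (action_ops [set` l]) (gen (action_ops [set` l]) [set` s]).
Proof.
elim: l => [|v l IH].
  have -> : action_ops [set` [::]] = set0 by apply/seteqP; split => [t [] //|//].
  exact: noetherian_span.
have -> : action_ops [set` v :: l] = action_ops [set` l] `|` [set act v].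
  apply/seteqP; split => [_ [g /= + <-]|t].
    by rewrite inE => /orP[/eqP ->|gl]; [right|left; exists g].
  by case=> [[g gl <-]|->]; [exists g => //=; rewrite inE (gl : g \in l) orbT|exists v => //=; rewrite mem_head].
set O := action_ops _ in IH *; set B := gen O _ in IH.
have addO' : addops (O `|` [set act v]).
  by move=> _ [[g _ <-]|->] x y; apply: actB.
have commO o : O o -> forall x, o (act v x) = act v (o x).
  by move=> [g _ <-] x; apply: action_comm.
apply: noetherian_sub (noetherian_adjoin addO' commO (gen_submodule _ _) IH).
by apply: gen_mono; exact: sub_gen.
Qed.

Lemma stable_subgroup (G : set V) (S N : set A) : subgroup N ->
  (forall v, G v -> forall x, N x -> N (act v x) /\ N (act (- v) x)) ->
  stable (action_ops (gen set0 G)) N.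
Proof.
move=> hN hG _ [g hg <-].
pose Q := [set g | forall x, N x -> N (act g x) /\ N (act (- g) x)].
suff : Q g by move=> h x /h[].
apply: (@gen_min _ set0 G Q) hg => //; split => //; split.
  by move=> x Nx; rewrite oppr0 (act0 hact).
move=> g1 g2 h1 h2 x Nx; rewrite opprB !(actD hact).
by split; [apply: (h1 _ (h2 _ Nx).2).1|apply: (h2 _ (h1 _ Nx).2).1].
Qed.

(** Once the list is closed under negation, stability under its elements is the same as stability
    under the group [G] that they generate. *)
Lemma noetherian_action (l : seq V) (s : seq A) :
  let G := gen set0 [set` l] in noetherian (action_ops G) (gen (action_ops G) [set` s]).
Proof.
move=> G; pose l' := l ++ map -%R l; set B := gen _ _.
have lG : [set` l'] `<=` G.
  move=> v /=; rewrite mem_cat => /orP[vl|/mapP[w wl ->]]; first exact: sub_gen.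
  by apply: (subgroupN (gen_submodule _ _).1); exact: sub_gen.
have sO : action_ops [set` l'] `<=` action_ops G by move=> _ [v vl <-]; exists v => //; exact: lG.
have subE N : submodule (action_ops [set` l']) N -> submodule (action_ops G) N.
  move=> [hN sN]; split=> //; apply: stable_subgroup => // v vl x Nx.
  by split; apply: sN => //; [exists v|exists (- v)]; rewrite //= mem_cat ?(vl : v \in l) // map_f ?orbT.
have BB : B `<=` gen (action_ops [set` l']) [set` s].
  by apply: gen_min; [apply/subE; exact: gen_submodule|exact: sub_gen].
move=> N hN NB; have [||t tN Nt] := @noetherian_action_seq l' s N.
- by split; [case: hN|move=> o /sO Oo; apply: hN.2].
- by move=> x /NB /BB.
by exists t => // x /Nt; exact: gen_ops.
Qed.

End Action.

(** * The bar complex and dimension shifting *)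

Section AdditiveOn.
Variables (A B : zmodType).
(** Additivity is only required on [M], since maps such as [ext] take junk values elsewhere. *)
Definition additive_on (M : set A) (f : A -> B) :=
  forall x y, M x -> M y -> f (x - y) = f x - f y.
Variables (M : set A) (f : A -> B).
Hypotheses (hM : subgroup M) (hf : additive_on M f).
Lemma additive_on0 : f 0 = 0.
Proof. by have := hf (subgroup0 hM) (subgroup0 hM); rewrite !subrr. Qed.
Lemma additive_onN x : M x -> f (- x) = - f x.
Proof. by move=> Mx; rewrite -[in LHS](sub0r x) hf ?additive_on0 ?sub0r //; exact: subgroup0 hM. Qed.
Lemma additive_onD x y : M x -> M y -> f (x + y) = f x + f y.
Proof. by move=> Mx My; rewrite -[y in LHS]opprK hf ?additive_onN ?opprK //; exact: subgroupN. Qed.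
End AdditiveOn.

Lemma subgroup_setT (A : zmodType) : subgroup [set: A]. Proof. by []. Qed.
#[local] Hint Resolve subgroup_setT : core.

Definition additive_total (A B : zmodType) (f : A -> B) := additive_on setT f.

(** * Finitely supported functions and their linear maps *)

Section FiniteSupport.
Variables (K : choiceType) (A : zmodType).
Implicit Types (k : K) (a : A) (c : seq (K * A)) (phi psi : K -> A).

Definition single k a : K -> A := fun u => if u == k then a else 0.
Definition lin (B : zmodType) (D : K -> A -> B) c : B := \sum_(e <- c) D e.1 e.2.
Definition evs c : K -> A := lin single c.
Definition finsupp phi := exists c, phi = evs c.

(* The linear extension of [D] to finitely supported functions, with junk value elsewhere. *)
Definition ext (B : zmodType) (D : K -> A -> B) phi : B :=
  lin D (xget [::] [set c | phi = evs c]).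

Lemma single_additive k : additive_total (single k).
Proof.
by move=> x y _ _; apply/funext => u; rewrite /single !fctE; case: eqP; rewrite ?subrr.
Qed.

Lemma single0 k : single k 0 = 0.
Proof. exact: additive_on0 (@subgroup_setT _) (@single_additive k). Qed.

Section Lin.
Variables (B : zmodType) (D : K -> A -> B).
Hypothesis hD : forall k, additive_total (D k).

Let D0 k : D k 0 = 0. Proof. exact: additive_on0 (hD k). Qed.
Let DD k x y : D k (x + y) = D k x + D k y.
Proof. by rewrite (additive_onD (@subgroup_setT _) (hD k)). Qed.

(** Terms with equal keys merge because each [D k] is additive. Hence [lin D c] depends on the
    formal sum [c] only through the function [evs c], which makes [ext] well defined. *)
Lemma lin_keys c l : uniq l -> {subset [seq e.1 | e <- c] <= l} ->
  lin D c = \sum_(k <- l) D k (evs c k).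
Proof.
move=> ul; elim: c => [|e c IH] h.
  by rewrite /lin big_nil big1 // => k _; rewrite /evs /lin big_nil D0.
rewrite /lin big_cons -/(lin D c) IH; last by move=> k kc; apply: h; rewrite inE kc orbT.
have -> : D e.1 e.2 = \sum_(k <- l) D k (single e.1 e.2 k).
  rewrite (bigD1_seq e.1) //=; last by apply: h; rewrite mem_head.
  rewrite /single eqxx big1 ?addr0 // => k /negPf ->; exact: D0.
by rewrite -big_split /=; apply: eq_bigr => k _; rewrite -DD /evs /lin big_cons.
Qed.

Lemma lin_evs c c' : evs c = evs c' -> lin D c = lin D c'.
Proof.
move=> ecc'; pose l := undup [seq e.1 | e <- c ++ c'].
rewrite (@lin_keys c l) ?undup_uniq ?(@lin_keys c' l) ?undup_uniq ?ecc' //;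
  by move=> k; rewrite mem_undup map_cat mem_cat => ->; rewrite ?orbT.
Qed.

Lemma ext_evs c : ext D (evs c) = lin D c.
Proof. by apply: lin_evs; rewrite -(@xgetPex _ [::] [set c' | evs c = evs c']) //; exists c. Qed.

Lemma ext_single k a : ext D (single k a) = D k a.
Proof.
have -> : single k a = evs [:: (k, a)] by rewrite /evs /lin big_seq1.
by rewrite ext_evs /lin big_seq1.
Qed.

Definition negs c := [seq (e.1, - e.2) | e <- c].

Lemma lin_subr c c' : lin D (c ++ negs c') = lin D c - lin D c'.
Proof.
rewrite /lin big_cat big_map /= -sumrN; congr (_ + _).
by apply: eq_bigr => e _; rewrite (additive_onN (@subgroup_setT _) (hD e.1)).
Qed.

End Lin.

Lemma evs_subr c c' : evs (c ++ negs c') = evs c - evs c'.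
Proof. exact: lin_subr single_additive c c'. Qed.

Lemma finsupp_subgroup : subgroup finsupp.
Proof.
split; first by exists [::]; rewrite /evs /lin big_nil.
by move=> _ _ [c ->] [c' ->]; exists (c ++ negs c'); rewrite evs_subr.
Qed.

Lemma finsupp_single k a : finsupp (single k a).
Proof. by exists [:: (k, a)]; rewrite /evs /lin big_seq1. Qed.

Lemma ext_additive (B : zmodType) (D : K -> A -> B) :
  (forall k, additive_total (D k)) -> additive_on finsupp (ext D).
Proof. by move=> hD _ _ [c ->] [c' ->]; rewrite -evs_subr !ext_evs // lin_subr. Qed.

Lemma finsupp_support phi : finsupp phi ->
  exists l : seq K, [/\ uniq l, phi = \sum_(k <- l) single k (phi k)
    & forall k, k \notin l -> phi k = 0].
Proof.
move=> [c ->]; pose l := undup [seq e.1 | e <- c].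
have E : evs c = \sum_(k <- l) single k (evs c k).
  apply: (lin_keys single_additive); first exact: undup_uniq.
  by move=> k; rewrite mem_undup.
exists l; split => //; first exact: undup_uniq.
move=> k kl; rewrite E fct_sumE big1_seq // => k' /= k'l.
by rewrite /single; case: eqP kl => // ->; rewrite k'l.
Qed.

Lemma finsupp_ind (Q : set (K -> A)) phi : subgroup Q -> finsupp phi ->
  (forall k, Q (single k (phi k))) -> Q phi.
Proof.
by move=> hQ /finsupp_support[l [_ E _]] h; rewrite E; apply: subgroup_sum => // k _.
Qed.

End FiniteSupport.

Lemma equalizer_subgroup (A B : zmodType) (M : set A) (f1 f2 : A -> B) :
  subgroup M -> additive_on M f1 -> additive_on M f2 ->
  subgroup [set x | M x /\ f1 x = f2 x].
Proof.
move=> hM h1 h2; split; first by split; [exact: subgroup0|rewrite (additive_on0 hM h1) (additive_on0 hM h2)].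
by move=> x y [Mx ex] [My ey]; split; [exact: subgroupB|rewrite h1 // h2 // ex ey].
Qed.

Lemma finsupp_ext_eq (K : choiceType) (A B : zmodType) (f1 f2 : (K -> A) -> B) phi :
  additive_on (@finsupp K A) f1 -> additive_on (@finsupp K A) f2 -> finsupp phi ->
  (forall k, f1 (single k (phi k)) = f2 (single k (phi k))) -> f1 phi = f2 phi.
Proof.
move=> h1 h2 sphi h; have hQ := equalizer_subgroup (@finsupp_subgroup K A) h1 h2.
have [//] : [set x | finsupp x /\ f1 x = f2 x] phi.
apply: finsupp_ind => // k; split => //; exact: finsupp_single.
Qed.

(** * The bar complex on finitely supported functions of tuples *)

Section Bar.
Variable V : zmodType.

Section BarOps.
Variable A : zmodType.
Implicit Types (s t : seq V) (m : A) (phi psi X : seq V -> A).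

Definition prefix1 (g : V) phi : seq V -> A :=
  fun t => if t is x :: t' then if x == g then phi t' else 0 else 0.

Lemma prefix1_additive g : additive_total (prefix1 g).
Proof.
by move=> x y _ _; apply/funext => -[|u t]; rewrite /prefix1 !fctE ?subrr //; case: eqP; rewrite ?subrr.
Qed.

Lemma prefix1_single g s m : prefix1 g (single s m) = single (g :: s) m.
Proof.
apply/funext => -[|u t]; rewrite /prefix1 /single //= eqseq_cons.
by case: eqP.
Qed.

(* The bar boundary splits as [m[g|s] |-> (g m)[s] - inner], where [inner] involves only the
   trivial action: [inner [g|h|s] = [g+h|s] - g|(inner [h|s])] and [inner [g] = []]. *)
Fixpoint inner s m : seq V -> A :=
  if s is g :: s' then
    if s' is h :: s'' then single ((g + h) :: s'') m - prefix1 g (inner s' m)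
    else single [::] m
  else 0.

Lemma inner_cons2 g h s m :
  inner (g :: h :: s) m = single ((g + h) :: s) m - prefix1 g (inner (h :: s) m).
Proof. by []. Qed.

Lemma finsupp_prefix1 g X : finsupp X -> finsupp (prefix1 g X).
Proof.
move=> fX; pose Q := [set X | finsupp (prefix1 g X)].
apply: (@finsupp_ind _ _ Q) fX _.
  split; first by rewrite /Q /= (additive_on0 _ (@prefix1_additive g)) //; exact: subgroup0 (finsupp_subgroup _ _).
  by move=> x y Qx Qy; rewrite /Q /= prefix1_additive //; exact: subgroupB (finsupp_subgroup _ _) Qx Qy.
by move=> k; rewrite /Q /= prefix1_single; exact: finsupp_single.
Qed.

Lemma finsupp_inner s m : finsupp (inner s m).
Proof.
elim: s => [|g [|h s] IH]; first exact: subgroup0 (finsupp_subgroup _ _).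
  exact: finsupp_single.
by rewrite inner_cons2; apply: (subgroupB (finsupp_subgroup _ _)); [exact: finsupp_single|exact: finsupp_prefix1].
Qed.

Lemma inner_additive s : additive_total (inner s).
Proof.
elim: s => [|g [|h s] IH] x y _ _; first by rewrite /= subrr.
  exact: single_additive.
by rewrite !inner_cons2 IH // prefix1_additive // single_additive // opprD addrACA -opprD.
Qed.

End BarOps.

(** [inner] uses nothing but the group structure of the coefficients, so it commutes with additive
    maps. This is applied to the action, to the evaluation of a free module and to coordinates. *)
Lemma inner_natural (A B : zmodType) (M : set A) (f : A -> B) s m u :
  subgroup M -> additive_on M f -> M m ->
  M (inner s m u) /\ f (inner s m u) = inner s (f m) u.
Proof.
move=> hM hf Mm; have f0 := additive_on0 hM hf; have M0 := subgroup0 hM.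
have sE (T : choiceType) (k w : T) : M (single k m w) /\ f (single k m w) = single k (f m) w.
  by rewrite /single; case: eqP; split.
elim: s u => [|g [|h s] IH] u; first by split.
  exact: sE.
rewrite !inner_cons2 !fctE.
have [Mp fp] : M (prefix1 g (inner (h :: s) m) u) /\
    f (prefix1 g (inner (h :: s) m) u) = prefix1 g (inner (h :: s) (f m)) u.
  by case: u => [|x u]; rewrite /prefix1 //; case: eqP => // _; split; case: (IH u).
have [Ms fs] := sE _ ((g + h) :: s) u; split; first exact: subgroupB.
by rewrite hf // fs fp.
Qed.

Section Boundary.
Variables (A : zmodType) (act : V -> A -> A).
Hypothesis hact : is_action act.

Definition bar_single (s : seq V) (m : A) : seq V -> A :=
  if s is g :: s' then single s' (act g m) - inner s m else 0.

Definition boundary : (seq V -> A) -> (seq V -> A) := ext bar_single.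
Definition inner_ext : (seq V -> A) -> (seq V -> A) := ext (@inner A).

Let actA g : additive_total (act g). Proof. by move=> x y _ _; apply: actB. Qed.

Lemma bar_single_additive s : additive_total (bar_single s).
Proof.
case: s => [|g s] x y _ _; first by rewrite /= subrr.
by rewrite /bar_single actA // single_additive // inner_additive // opprD addrACA -opprD.
Qed.

Lemma boundary_additive : additive_on (@finsupp _ A) boundary.
Proof. exact: ext_additive bar_single_additive. Qed.
Lemma inner_ext_additive : additive_on (@finsupp _ A) inner_ext.
Proof. exact: ext_additive (@inner_additive A). Qed.
Lemma boundary_single s m : boundary (single s m) = bar_single s m.
Proof. exact: ext_single bar_single_additive s m. Qed.
Lemma inner_ext_single s m : inner_ext (single s m) = inner s m.
Proof. exact: ext_single (@inner_additive A) s m. Qed.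

Lemma finsupp_bar_single s m : finsupp (bar_single s m).
Proof.
case: s => [|g s]; first exact: subgroup0 (finsupp_subgroup _ _).
exact: subgroupB (finsupp_subgroup _ _) (finsupp_single _ _) (finsupp_inner _ _).
Qed.

Lemma finsupp_boundary X : finsupp X -> finsupp (boundary X).
Proof.
move=> fX; pose Q := [set X | finsupp X /\ finsupp (boundary X)].
have [//] : Q X; apply: finsupp_ind fX _.
  split; first by rewrite /Q /= (additive_on0 (finsupp_subgroup _ _) boundary_additive); split;
    exact: subgroup0 (finsupp_subgroup _ _).
  move=> x y [fx Qx] [fy Qy]; split; first exact: subgroupB (finsupp_subgroup _ _) fx fy.
  by rewrite boundary_additive //; exact: subgroupB (finsupp_subgroup _ _) Qx Qy.
by move=> k; split; [exact: finsupp_single|rewrite boundary_single; exact: finsupp_bar_single].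
Qed.

Lemma inner_ext_prefix2 g h X : finsupp X ->
  inner_ext (prefix1 g (prefix1 h X)) = prefix1 (g + h) X - prefix1 g (inner_ext (prefix1 h X)).
Proof.
move=> fX; pose f1 := fun X => inner_ext (prefix1 g (prefix1 h X)).
pose f2 := fun X => prefix1 (g + h) X - prefix1 g (inner_ext (prefix1 h X)).
apply: (@finsupp_ext_eq _ _ _ f1 f2) fX _.
- move=> x y fx fy; rewrite /f1 !prefix1_additive // inner_ext_additive //; do 2 apply: finsupp_prefix1 => //.
- move=> x y fx fy; rewrite /f2 prefix1_additive // [prefix1 h _]prefix1_additive //.
  rewrite inner_ext_additive //; try exact: finsupp_prefix1.
  by rewrite [prefix1 g _]prefix1_additive // opprD addrACA -opprD.
- by move=> k; rewrite /f1 /f2 !prefix1_single !inner_ext_single inner_cons2.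
Qed.

(** This identity replaces the usual bookkeeping of signs and indices in the proof that the boundary
    squares to zero. *)
Lemma inner_ext_inner g h s m :
  inner_ext (prefix1 g (inner (h :: s) m)) = inner ((g + h) :: s) m.
Proof.
elim: s h g => [|k s IH] h g; first by rewrite prefix1_single inner_ext_single.
rewrite inner_cons2 prefix1_additive // inner_ext_additive; last first.
- by do 2 apply: finsupp_prefix1; exact: finsupp_inner.
- by rewrite prefix1_single; exact: finsupp_single.
rewrite prefix1_single inner_ext_single inner_ext_prefix2; last exact: finsupp_inner.
rewrite IH inner_cons2 (inner_cons2 (g + h)) opprB addrA addrNK.
by rewrite [g + (h + k)]addrA.
Qed.

Lemma boundary_prefix1 g X : finsupp X ->
  boundary (prefix1 g X) = (fun t => act g (X t)) - inner_ext (prefix1 g X).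
Proof.
move=> fX; pose f1 := fun X => boundary (prefix1 g X).
pose f2 := fun X : seq V -> A => (fun t => act g (X t)) - inner_ext (prefix1 g X).
apply: (@finsupp_ext_eq _ _ _ f1 f2) fX _.
- by move=> x y fx fy; rewrite /f1 !prefix1_additive // boundary_additive //; exact: finsupp_prefix1.
- move=> x y fx fy; rewrite /f2 prefix1_additive // inner_ext_additive //; try exact: finsupp_prefix1.
  have -> : (fun t => act g ((x - y) t)) = (fun t => act g (x t)) - (fun t => act g (y t)).
    by apply/funext => t; rewrite !fctE actA.
  by rewrite opprD addrACA -opprD.
- move=> k; rewrite /f1 /f2 !prefix1_single boundary_single inner_ext_single /bar_single; congr (_ - _).
  by apply/funext => t; rewrite /single; case: eqP => // _; rewrite (additive_on0 _ (actA g)).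
Qed.

Lemma boundary_bar_single s m : boundary (bar_single s m) = 0.
Proof.
have B0 := additive_on0 (finsupp_subgroup _ _) boundary_additive.
case: s => [|g [|h s]]; first exact: B0.
  rewrite /bar_single /= boundary_additive; try exact: finsupp_single.
  by rewrite !boundary_single /= subrr.
have fp : finsupp (prefix1 g (inner (h :: s) m)) by apply: finsupp_prefix1; exact: finsupp_inner.
rewrite /bar_single boundary_additive; [|exact: finsupp_single|exact: finsupp_inner].
rewrite inner_cons2 boundary_additive; [|exact: finsupp_single|exact: fp].
rewrite !boundary_single boundary_prefix1; last exact: finsupp_inner.
rewrite inner_ext_inner /bar_single.
have -> : (fun t => act g (inner (h :: s) m t)) = inner (h :: s) (act g m).
  by apply/funext => t; have [_ ->] := inner_natural (h :: s) t (@subgroup_setT A) (actA g) (I : setT m).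
(* Commutativity of the group identifies letting [g] and then [h] act with letting [g + h] act. *)
rewrite addrC (actD hact) (action_comm hact h g).
set a := single _ _; set c := inner (g + h :: s) m; set b := inner _ _.
have -> : a - c - (b - c) = a - b by rewrite opprB addrA addrNK.
by rewrite addNr.
Qed.

Lemma boundary_boundary X : finsupp X -> boundary (boundary X) = 0.
Proof.
move=> fX; pose f1 X := boundary (boundary X).
apply: (@finsupp_ext_eq _ _ _ f1 (fun=> 0)) fX _.
- move=> x y fx fy; rewrite /f1 boundary_additive // boundary_additive //; exact: finsupp_boundary.
- by move=> x y _ _; rewrite subrr.
- by move=> k; rewrite /f1 boundary_single boundary_bar_single.
Qed.

Definition chains (G : set V) (M : set A) p : set (seq V -> A) :=
  [set X | finsupp X /\ forall t, M (X t) /\ (X t != 0 -> size t = p /\ forall g, g \in t -> G g)].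

Lemma chains_finsupp G M p X : chains G M p X -> finsupp X. Proof. by case. Qed.

Section Chains.
Variables (G : set V) (M : set A).
Hypotheses (hG : subgroup G) (hM : submodule (action_ops act G) M).

Lemma chains_subgroup p : subgroup (chains G M p).
Proof.
split.
  split; first exact: subgroup0 (finsupp_subgroup _ _).
  by move=> t; rewrite (_ : (0 : seq V -> A) t = 0) // eqxx; split => //; exact: subgroup0 hM.1.
move=> X Y [fX hX] [fY hY]; split; first exact: subgroupB (finsupp_subgroup _ _) fX fY.
move=> t; have [MX sX] := hX t; have [MY sY] := hY t; rewrite !fctE.
split; first exact: subgroupB hM.1 MX MY.
by have [->|/sX //] := eqVneq (X t) 0; rewrite sub0r oppr_eq0.
Qed.

Lemma chains_single p t m : size t = p -> (forall g, g \in t -> G g) -> M m ->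
  chains G M p (single t m).
Proof.
move=> st Gt Mm; split; first exact: finsupp_single.
move=> u; rewrite /single; case: eqP => [-> //|_]; split; first exact: subgroup0 hM.1.
by rewrite eqxx.
Qed.

Lemma chains_ind (Q : set (seq V -> A)) p X : subgroup Q -> chains G M p X ->
  (forall t m, size t = p -> (forall g, g \in t -> G g) -> M m -> Q (single t m)) -> Q X.
Proof.
move=> hQ [fX hX] h; apply: (finsupp_ind hQ fX) => t; have [Mt ht] := hX t.
have [->|/ht[st Gt]] := eqVneq (X t) 0; first by rewrite single0; exact: subgroup0.
exact: h.
Qed.

Lemma chains_prefix1 g p X : G g -> chains G M p X -> chains G M p.+1 (prefix1 g X).
Proof.
move=> Gg [fX hX]; split; first exact: finsupp_prefix1.
have M0 := subgroup0 hM.1.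
case=> [|x t]; rewrite /prefix1 ?eqxx //; case: eqP => [->|]; rewrite ?eqxx //.
have [Mt ht] := hX t; split => // /ht[<- Gt]; split => // y.
by rewrite inE => /orP[/eqP ->|/Gt].
Qed.

Lemma chains_inner p t m : size t = p.+1 -> (forall g, g \in t -> G g) -> M m ->
  chains G M p (inner t m).
Proof.
elim: t p => [|g [|h t] IH] p //; first by case=> <- _ Mm; exact: chains_single.
case=> <- Gt Mm; rewrite inner_cons2; apply: (subgroupB (chains_subgroup _)).
  apply: chains_single => // x; rewrite inE => /orP[/eqP ->|xt].
    by apply: subgroupD => //; apply: Gt; rewrite !inE eqxx ?orbT.
  by apply: Gt; rewrite !inE xt !orbT.
apply: chains_prefix1; first by apply: Gt; rewrite mem_head.
by apply: IH => // x xt; apply: Gt; rewrite inE xt orbT.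
Qed.

Lemma chains_boundary p X : chains G M p.+1 X -> chains G M p (boundary X).
Proof.
move=> cX; pose Q := [set X | finsupp X /\ chains G M p (boundary X)].
have [//] : Q X; apply: (chains_ind _ cX).
  split; first by split; [exact: subgroup0 (finsupp_subgroup _ _)|
    rewrite (additive_on0 (finsupp_subgroup _ _) boundary_additive); exact: subgroup0 (chains_subgroup _)].
  move=> x y [fx cx] [fy cy]; split; first exact: subgroupB (finsupp_subgroup _ _) fx fy.
  by rewrite boundary_additive //; exact: subgroupB (chains_subgroup _) cx cy.
move=> [|g t] m // st Gt Mm; split; first exact: finsupp_single.
rewrite boundary_single; apply: (subgroupB (chains_subgroup _)); last exact: chains_inner.
apply: chains_single => //; first by case: st.
  by move=> x xt; apply: Gt; rewrite inE xt orbT.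
by apply: hM.2 => //; exists g => //; apply: Gt; rewrite mem_head.
Qed.

Definition cycles p : set (seq V -> A) := [set X | chains G M p X /\ boundary X = 0].
Definition boundaries p : set (seq V -> A) := [set boundary X | X in chains G M p.+1].

Lemma cycles_subgroup p : subgroup (cycles p).
Proof.
have B0 := additive_on0 (finsupp_subgroup _ _) boundary_additive.
split; first by split; [exact: subgroup0 (chains_subgroup _)|].
move=> X Y [cX bX] [cY bY]; split; first exact: subgroupB (chains_subgroup _) cX cY.
by rewrite boundary_additive ?bX ?bY ?subrr //; [case: cX|case: cY].
Qed.

Lemma boundaries_subgroup p : subgroup (boundaries p).
Proof.
have B0 := additive_on0 (finsupp_subgroup _ _) boundary_additive.
split; first by exists 0 => //; exact: subgroup0 (chains_subgroup _).
move=> _ _ [X cX <-] [Y cY <-]; exists (X - Y); first exact: subgroupB (chains_subgroup _) cX cY.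
by rewrite boundary_additive //; [case: cX|case: cY].
Qed.

Lemma boundaries_cycles p : boundaries p `<=` cycles p.
Proof.
move=> _ [X cX <-]; split; first exact: chains_boundary.
by apply: boundary_boundary; case: cX.
Qed.

Definition homology_fg p := exists2 s : seq (seq V -> A), [set` s] `<=` cycles p &
  cycles p `<=` gen set0 ([set` s] `|` boundaries p).

(** H_0 is the group of coinvariants: the difference of [act g x] and [x] is the boundary of x[g],
    so generators of [M] under [G] already generate H_0 over Z. *)
Lemma homology0_fg (s : seq A) : [set` s] `<=` M -> M `<=` gen (action_ops act G) [set` s] ->
  homology_fg 0.
Proof.
move=> sM Ms; exists [seq single [::] m | m <- s].
  move=> _ /mapP[m /sM Mm ->]; split; first exact: chains_single.
  by rewrite boundary_single.
move=> X [cX _]; set Y := gen _ _.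
have hY : subgroup Y by exact: (gen_submodule _ _).1.
have YB : boundaries 0 `<=` Y by move=> x bx; apply: sub_gen; right.
apply: (chains_ind hY cX) => -[|//] m _ _ Mm.
pose Q := [set m | M m /\ Y (single [::] m)].
have [//] : Q m; apply: gen_min (Ms _ Mm); last first.
  by move=> x xs; split; [exact: sM|apply: sub_gen; left; rewrite /= map_f].
split; first split.
- by split; [exact: subgroup0 hM.1|rewrite single0; exact: subgroup0 hY].
- move=> x y [Mx Yx] [My Yy]; split; first exact: subgroupB hM.1 Mx My.
  by rewrite single_additive //; exact: subgroupB hY Yx Yy.
- move=> _ [g Gg <-] x [Mx Yx]; split; first by apply: hM.2 => //; exists g.
  rewrite -[single _ _](subrK (single [::] x)); apply: (subgroupD hY) => //; apply: YB.
  exists (single [:: g] x); last by rewrite boundary_single.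
  by apply: chains_single => // y; rewrite inE => /eqP ->.
Qed.

End Chains.
End Boundary.
End Bar.

Lemma additive_totalMz (A B : zmodType) (f : A -> B) x z :
  additive_total f -> f (x *~ z) = f x *~ z.
Proof.
move=> hf; have f0 := additive_on0 (@subgroup_setT _) hf.
have fn n : f (x *+ n) = f x *+ n.
  by elim: n => // n IH; rewrite !mulrS (additive_onD (@subgroup_setT _) hf) // IH.
by case: z => n; rewrite ?NegzE ?mulrNz -?pmulrn ?(additive_onN (@subgroup_setT _) hf) // fn.
Qed.

(* 0 -> relations -> free_mod -> M -> 0 is exact and the bar complex of the free module is acyclic,
   so that H_(p+1)(M) is controlled by H_p(relations). *)
Section DimensionShift.
Variables (V A : zmodType) (act : V -> A -> A) (G : set V) (M : set A) (s : seq A).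
Hypotheses (hact : is_action act) (hG : subgroup G) (hM : submodule (action_ops act G) M).
Hypotheses (sM : [set` s] `<=` M) (Ms : M `<=` gen (action_ops act G) [set` s]).

Local Notation key := (V * 'I_(size s))%type.
Local Notation F := (key -> int).

Let actA g : additive_total (act g). Proof. by move=> x y _ _; apply: actB. Qed.

Definition shift_act (g : V) (x : F) : F := fun k => x (k.1 - g, k.2).

Lemma shift_is_action : is_action shift_act.
Proof.
split=> [g x y|x|g h x]; apply/funext => -[v i]; rewrite /shift_act ?fctE ?subr0 //=.
by rewrite opprD addrA.
Qed.

Lemma shift_single g v i z : shift_act g (single (v, i) z) = single (v + g, i) z.
Proof.
by apply/funext => -[w j]; rewrite /shift_act /single /= !xpair_eqE subr_eq.
Qed.

Definition free_gens : seq F := [seq single (0, i) 1 | i <- enum 'I_(size s)].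
(** A copy of Z[G]^(size s): the functions of finite support in G x I. The key [(v, i)] stands for
    the translate by [v] of the [i]-th basis vector. *)
Definition free_mod : set F := gen (action_ops shift_act G) [set` free_gens].

Lemma free_submodule : submodule (action_ops shift_act G) free_mod.
Proof. exact: gen_submodule. Qed.

Lemma single_mulrz (k : key) (z : int) : single k z = single k 1 *~ z.
Proof.
case: z => n; rewrite ?NegzE ?mulrNz -?pmulrn; apply/funext => u; rewrite /single ?opprfctE natmulfctE;
  by case: eqP; rewrite ?mul0rn ?natz ?oppr0.
Qed.

Lemma free_mod_single v i z : G v -> free_mod (single (v, i) z).
Proof.
move=> Gv; rewrite single_mulrz; apply: (subgroupMz _ free_submodule.1).
rewrite -[v]add0r -shift_single; apply: free_submodule.2; first by exists v.
by apply: sub_gen; apply: map_f; rewrite mem_enum.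
Qed.

Lemma free_mod_finsupp (x : F) : free_mod x -> finsupp x /\ forall k, x k != 0 -> G k.1.
Proof.
apply: (@gen_min _ _ _ [set x : F | finsupp x /\ forall k, x k != 0 -> G k.1]).
  have hf := @finsupp_subgroup key int; split; first split.
  - by split; [exact: subgroup0 hf|move=> k; rewrite eqxx].
  - move=> y z [fy sy] [fz sz]; split; first exact: subgroupB hf fy fz.
    by move=> k; rewrite !fctE; have [->|/sy //] := eqVneq (y k) 0; rewrite sub0r oppr_eq0 => /sz.
  - move=> _ [g Gg <-] y [fy sy]; split.
      pose Q := [set y : F | finsupp (shift_act g y)].
      apply: (@finsupp_ind _ _ Q) fy _ => [|[v i]]; last by rewrite /Q /= shift_single; exact: finsupp_single.
      split; first exact: subgroup0 hf.
      by move=> a b Qa Qb; rewrite /Q /= (actB shift_is_action); exact: subgroupB hf Qa Qb.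
    by move=> [v i] /sy /= Gvg; rewrite -[v](subrK g); exact: subgroupD.
move=> _ /mapP[i _ ->]; split; first exact: finsupp_single.
by move=> k; rewrite /single; case: (k =P (0, i)) => [->|_]; [move=> _; exact: subgroup0|rewrite eqxx].
Qed.

Lemma free_mod_ind (Q : set F) (x : F) : subgroup Q -> free_mod x ->
  (forall v i z, G v -> Q (single (v, i) z)) -> Q x.
Proof.
move=> hQ /free_mod_finsupp[fx sx] h; apply: finsupp_ind fx _ => // -[v i].
have [->|/sx Gv] := eqVneq (x (v, i)) 0; first by rewrite single0; exact: subgroup0.
exact: h.
Qed.

Definition eval_single (k : key) (z : int) : A := act k.1 (nth 0 s k.2) *~ z.
Definition eval_free : F -> A := ext eval_single.

Lemma eval_single_additive k : additive_total (eval_single k).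
Proof. by move=> x y _ _; rewrite /eval_single mulrzBr. Qed.

Lemma eval_additive : additive_on free_mod eval_free.
Proof.
move=> x y /free_mod_finsupp[fx _] /free_mod_finsupp[fy _].
exact: ext_additive eval_single_additive _ _ fx fy.
Qed.

Lemma eval_freeE k z : eval_free (single k z) = eval_single k z.
Proof. exact: ext_single eval_single_additive k z. Qed.

Lemma eval_act g x : G g -> free_mod x -> eval_free (shift_act g x) = act g (eval_free x).
Proof.
move=> Gg fx; have hF := free_submodule.
have Fg y : free_mod y -> free_mod (shift_act g y) by move=> Fy; apply: hF.2 => //; exists g.
have hQ := @equalizer_subgroup _ _ free_mod (eval_free \o shift_act g) (act g \o eval_free) hF.1.
have [] // := @free_mod_ind _ x (hQ _ _) fx.
- by move=> y z Fy Fz /=; rewrite (actB shift_is_action) eval_additive //; exact: Fg.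
- by move=> y z Fy Fz /=; rewrite eval_additive // actA.
move=> v i z Gv; split; first exact: free_mod_single.
rewrite /= shift_single !eval_freeE /eval_single /=.
by rewrite addrC (actD hact) additive_totalMz.
Qed.

Lemma eval_sub x : free_mod x -> M (eval_free x).
Proof.
move=> fx; have [//] : [set x | free_mod x /\ M (eval_free x)] x; apply: free_mod_ind fx _ => [|v i z Gv].
  split; first by split; [exact: subgroup0 free_submodule.1|
    rewrite (additive_on0 free_submodule.1 eval_additive); exact: subgroup0 hM.1].
  move=> y z [Fy My] [Fz Mz]; split; first exact: subgroupB free_submodule.1 Fy Fz.
  by rewrite eval_additive //; exact: subgroupB hM.1 My Mz.
split; first exact: free_mod_single.
rewrite eval_freeE; apply: (subgroupMz _ hM.1); apply: hM.2; first by exists v.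
by apply: sM; apply: mem_nth.
Qed.

Lemma eval_surj m : M m -> exists2 x, free_mod x & eval_free x = m.
Proof.
move=> /Ms; have hF := free_submodule; apply: (@gen_min _ _ _ [set m | exists2 x, free_mod x & eval_free x = m]).
  split; first split.
  - by exists 0; [exact: subgroup0 hF.1|exact: additive_on0 hF.1 eval_additive].
  - move=> _ _ [x Fx <-] [y Fy <-]; exists (x - y); first exact: subgroupB hF.1 Fx Fy.
    exact: eval_additive.
  - move=> _ [g Gg <-] _ [x Fx <-]; exists (shift_act g x); last exact: eval_act.
    by apply: hF.2 => //; exists g.
move=> x xs; have lt : (index x s < size s)%N by rewrite index_mem.
exists (single (0, Ordinal lt) 1); first exact: free_mod_single (subgroup0 hG).
by rewrite eval_freeE /eval_single /= (act0 hact) nth_index.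
Qed.

Definition relations : set F := [set x | free_mod x /\ eval_free x = 0].

Lemma relations_submodule : submodule (action_ops shift_act G) relations.
Proof.
have hF := free_submodule; split.
  apply: (equalizer_subgroup hF.1 eval_additive) => x y _ _; by rewrite subrr.
move=> _ [g Gg <-] x [Fx ex]; split; first by apply: hF.2 => //; exists g.
by rewrite eval_act // ex (additive_on0 _ (actA g)).
Qed.

Local Notation bdF := (boundary shift_act).
Local Notation bdA := (boundary act).
Local Notation chF := (chains G free_mod).
Local Notation chM := (chains G M).
Local Notation chK := (chains G relations).

Definition push (X : seq V -> F) : seq V -> A := fun t => eval_free (X t).

Lemma push_additive p : additive_on (chF p) push.
Proof.
move=> X Y [_ hX] [_ hY]; apply/funext => t; rewrite /push !fctE.
by apply: eval_additive; [case: (hX t)|case: (hY t)].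
Qed.

Lemma push_single t x : push (single t x) = single t (eval_free x).
Proof.
apply/funext => u; rewrite /push /single; case: eqP => // _.
exact: additive_on0 free_submodule.1 eval_additive.
Qed.

Let chFs p : subgroup (chF p) := chains_subgroup free_submodule p.
Let chMs p : subgroup (chM p) := chains_subgroup hM p.
Lemma push_chains p X : chF p X -> chM p (push X).
Proof.
move=> cX; have [//] : [set X | chF p X /\ chM p (push X)] X.
apply: (chains_ind _ cX) => [|t x st Gt Fx]; last first.
  by split; [exact: (chains_single free_submodule st Gt Fx)|rewrite push_single; apply: (chains_single hM) => //; exact: eval_sub].
split; first by split; [exact: subgroup0|rewrite (additive_on0 (chFs p) (@push_additive p)); exact: subgroup0].
move=> Y Z [cY cpY] [cZ cpZ]; split; first exact: subgroupB (chFs p) cY cZ.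
by rewrite (push_additive cY cZ); exact: subgroupB (chMs p) cpY cpZ.
Qed.

Let bdF_additive := boundary_additive shift_is_action.
Let bdA_additive := boundary_additive hact.

Lemma push_boundary p X : chF p.+1 X -> push (bdF X) = bdA (push X).
Proof.
move=> cX; have [//] : [set X | chF p.+1 X /\ push (bdF X) = bdA (push X)] X.
apply: (chains_ind _ cX) => [|[|g t] x // st Gt Fx].
  apply: (@equalizer_subgroup _ _ (chF p.+1) (push \o bdF) (bdA \o push)) => // Y Z cY cZ /=.
    rewrite (bdF_additive (chains_finsupp cY) (chains_finsupp cZ)).
    by apply: (@push_additive p); exact: (chains_boundary shift_is_action hG free_submodule).
  rewrite (push_additive cY cZ) bdA_additive //.
    exact: chains_finsupp (push_chains cY).
  exact: chains_finsupp (push_chains cZ).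
split; first exact: (chains_single free_submodule st Gt Fx).
rewrite push_single (boundary_single hact) (boundary_single shift_is_action).
have Gg : G g by apply: Gt; rewrite mem_head.
rewrite /bar_single -eval_act // -push_single; apply/funext => u; rewrite /push !fctE.
have [Fi <-] := inner_natural (g :: t) u free_submodule.1 eval_additive Fx.
apply: eval_additive => //; rewrite /single; case: eqP => _; last exact: subgroup0 free_submodule.1.
by apply: free_submodule.2 => //; exists g.
Qed.

Lemma push_surj p Y : chM p Y -> exists2 X, chF p X & push X = Y.
Proof.
move=> cY; pose Q := [set Y | exists2 X, chF p X & push X = Y].
apply: (chains_ind (Q := Q) _ cY) => [|t m st Gt /eval_surj[x Fx <-]].
  split; first by exists 0; [exact: subgroup0|exact: additive_on0 (chFs p) (@push_additive p)].
  move=> _ _ [X cX <-] [Z cZ <-]; exists (X - Z); first exact: subgroupB (chFs p) cX cZ.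
  exact: push_additive cX cZ.
exists (single t x); last exact: push_single.
exact: (chains_single free_submodule st Gt Fx).
Qed.

(* Contracting homotopy of the bar complex of a free module: (g e_i)[t] |-> e_i[g|t]. *)
Definition homotopy (X : seq V -> F) : seq V -> F := fun t k =>
  if t is g :: t' then if k.1 == 0 then X t' (g, k.2) else 0 else 0.

Lemma homotopy_additive : additive_total homotopy.
Proof.
move=> X Y _ _; apply/funext => -[|g t]; apply/funext => k; rewrite /homotopy !fctE ?subrr //.
by case: eqP; rewrite ?subrr.
Qed.

Lemma homotopy_single t v i z :
  homotopy (single t (single (v, i) z)) = single (v :: t) (single (0, i) z).
Proof.
apply/funext => -[|w u]; apply/funext => -[x j]; rewrite /homotopy /single //= eqseq_cons.
case: (eqVneq u t) => _; rewrite ?andbF ?andbT; last by case: eqP.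
case: (eqVneq x 0) => [->|nx] /=; last by case: eqP => //= _; rewrite /single xpair_eqE (negPf nx).
by rewrite xpair_eqE; case: eqP => //= _; rewrite xpair_eqE eqxx.
Qed.

(** [inner] leaves the coefficient [single (v, i) z] untouched in every term, so the homotopy puts
    the same [v] in front of all of them. *)
Lemma homotopy_inner t v i z :
  homotopy (inner t (single (v, i) z)) = prefix1 v (inner t (single (0, i) z)).
Proof.
have ev k : additive_total (fun x : F => x k) by move=> x y _ _; rewrite fctE.
apply/funext => -[|w u]; apply/funext => -[x j]; rewrite /homotopy /prefix1 //=.
have E (y : F) k : inner t y u k = inner t (y k) u.
  by have [_ <-] := inner_natural t u (@subgroup_setT _) (ev k) (I : setT y).
have I0 : inner t (0 : int) u = 0 by rewrite (additive_on0 (@subgroup_setT _) (@inner_additive _ _ t)).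
rewrite E /single xpair_eqE; case: (eqVneq w v) => _ /=; last by rewrite I0; case: eqP.
by rewrite E xpair_eqE; case: (eqVneq x 0) => _ //=; rewrite I0.
Qed.

Lemma homotopy_chains p X : chF p X -> chF p.+1 (homotopy X).
Proof.
move=> cX; pose Q := [set X | chF p.+1 (homotopy X)].
have H0 := additive_on0 (@subgroup_setT _) homotopy_additive.
have hQ : subgroup Q.
  split; first by rewrite /Q /= H0; exact: subgroup0.
  by move=> Y Z; rewrite /Q /= homotopy_additive //; exact: subgroupB.
apply: (chains_ind (Q := Q) _ cX) => // t x st Gt Fx.
apply: (@free_mod_ind [set x | Q (single t x)]) Fx _ => [|v i z Gv].
  split; first by rewrite /= single0; exact: subgroup0 hQ.
  by move=> y z /= Qy Qz; rewrite single_additive //; exact: subgroupB hQ Qy Qz.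
rewrite /Q /= homotopy_single; apply: (chains_single free_submodule) => /=; first by rewrite st.
  by move=> g; rewrite inE => /orP[/eqP ->//|/Gt].
exact: free_mod_single (subgroup0 hG).
Qed.

(** The outer term of the boundary of e_i[v|t] gives back (v e_i)[t], and its inner terms cancel by
    [homotopy_inner]. The degree has to be positive: in degree 0 the formula would turn every chain
    into a boundary. *)
Lemma homotopyP p X : chF p.+1 X -> bdF (homotopy X) + homotopy (bdF X) = X.
Proof.
move=> cX; pose Q := [set X | chF p.+1 X /\ bdF (homotopy X) + homotopy (bdF X) = X].
have hQ : subgroup Q.
  apply: (@equalizer_subgroup _ _ (chF p.+1) (fun X => bdF (homotopy X) + homotopy (bdF X)) idfun) => // Y Z cY cZ.
  rewrite (bdF_additive (chains_finsupp cY) (chains_finsupp cZ)) !homotopy_additive //.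
  rewrite bdF_additive; [|exact: chains_finsupp (homotopy_chains cY)|exact: chains_finsupp (homotopy_chains cZ)].
  by rewrite addrACA -opprD.
have [//] : Q X; apply: (chains_ind (Q := Q) _ cX) => // -[|g t] x // st Gt Fx.
apply: (@free_mod_ind [set x | Q (single (g :: t) x)]) Fx _ => [|v i z Gv].
  split; first by rewrite /= single0; exact: subgroup0 hQ.
  by move=> y z /= Qy Qz; rewrite single_additive //; exact: subgroupB hQ Qy Qz.
split; first by apply: (chains_single free_submodule) => //; exact: free_mod_single.
rewrite homotopy_single !(boundary_single shift_is_action).
rewrite /bar_single !shift_single homotopy_additive // homotopy_single homotopy_inner add0r.
by rewrite inner_cons2 subrK.
Qed.

Lemma relations_chains p X : chF p X -> push X = 0 -> chK p X.
Proof.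
move=> [fX hX] pX; split => // t; have [Ft ht] := hX t; split => //; split => //.
by have := congr1 (@^~ t) pX.
Qed.

Lemma chains_relations p X : chK p X -> chF p X /\ push X = 0.
Proof.
move=> [fX hX]; split; last by apply/funext => t; case: (hX t) => -[].
by split => // t; have [[Ft _] ht] := hX t.
Qed.

(** The connecting map from H_(p+1)(M) to H_p(relations) is injective, because the free module has
    no homology in degree p+1; and a subgroup of a finitely generated abelian group is finitely
    generated. *)
Lemma homology_shift p :
  homology_fg shift_act G relations p -> homology_fg act G M p.+1.
Proof.
move=> [r rZ Zr]; have hK := relations_submodule.
have hZ := cycles_subgroup shift_is_action hK p.
(* The cycles of [relations] that bound in the free complex: the image of the connecting map, on the
   level of chains. *)
pose D := [set X | cycles shift_act G relations p X /\ exists2 Y, chF p.+1 Y & bdF Y = X].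
have hD : subgroup D.
  split.
    split; first exact: subgroup0 hZ.
    exists 0; first exact: subgroup0 (chFs _).
    exact: additive_on0 (finsupp_subgroup _ _) bdF_additive.
  move=> X X' [ZX [Y cY bY]] [ZX' [Y' cY' bY']]; split; first exact: subgroupB hZ ZX ZX'.
  exists (Y - Y'); first exact: subgroupB (chFs _) cY cY'.
  rewrite -bY -bY'; by rewrite bdF_additive //; [case: cY|case: cY'].
(* The elements of [r] need not bound in the free complex (for [p] = 0 this can fail), so generators
   of the part of their span inside [D] are taken instead. *)
pose P := gen set0 [set` r] `&` D.
have hP : submodule set0 P.
  have hr := (gen_submodule set0 [set` r]).1; split => //; split.
    by split; [exact: subgroup0 hr|exact: subgroup0 hD].
  by move=> X Y [rX DX] [rY DY]; split; [exact: subgroupB hr rX rY|exact: subgroupB hD DX DY].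
have [|t tP Pt] := @noetherian_span _ r P hP; first by move=> X [].
pose rel X Y := chF p.+1 Y /\ bdF Y = X.
have [|ys [r1 r2]] := @lift_seq _ _ rel t.
  by move=> X /tP[_ [_ [Y cY bY]]]; exists Y.
exists [seq push Y | Y <- ys].
  move=> _ /mapP[Y /r2[X /tP[_ [[/chains_relations[_ pX] _] _]] [cY bY]] ->].
  by split; [exact: push_chains|rewrite -(push_boundary cY) bY].
move=> z [cz bz]; set Y := gen _ _.
have hY : subgroup Y by exact: (gen_submodule _ _).1.
have BY W : chM p.+2 W -> Y (bdA W) by move=> cW; apply: sub_gen; right; exists W.
have [z' cz' pz'] := push_surj cz.
have ck : chF p (bdF z') := chains_boundary shift_is_action hG free_submodule cz'.
have Zk : cycles shift_act G relations p (bdF z').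
  split; first by apply: relations_chains => //; rewrite (push_boundary cz') pz'.
  exact: (boundary_boundary shift_is_action (chains_finsupp cz')).
have [q [b [rq Bb kE]]] : sumset (gen set0 [set` r]) (boundaries shift_act G relations p) (bdF z').
  have hB := boundaries_subgroup shift_is_action hK p.
  have hr := (gen_submodule set0 [set` r]).1.
  apply: gen_min (Zr _ Zk).
    by apply: sumset_submodule => //; split.
  move=> X [Xr|BX]; first by exists X, 0; rewrite addr0; split => //; [exact: sub_gen|exact: subgroup0 hB].
  by exists 0, X; rewrite add0r; split => //; exact: subgroup0 hr.
have Zb := boundaries_cycles shift_is_action hG hK Bb.
have [kap ckap bE] := Bb; have [cFkap pkap] := chains_relations ckap.
have Pq : P q.
  split => //; have -> : q = bdF z' - b by rewrite kE addrK.
  by apply: (subgroupB hD); split => //; [exists z'|exists kap].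
have [y cy [by_ Yy]] : exists2 y, chF p.+1 y & bdF y = q /\ Y (push y).
  apply: (@gen_min _ _ _ [set q | exists2 y, chF p.+1 y & bdF y = q /\ Y (push y)]) (Pt _ Pq).
    split => //; split.
      exists 0; first exact: subgroup0 (chFs _).
      rewrite (additive_on0 (finsupp_subgroup _ _) bdF_additive); split => //.
      by rewrite (additive_on0 (chFs _) (@push_additive p.+1)); exact: subgroup0 hY.
    move=> _ _ [u cu [<- Yu]] [v cv [<- Yv]]; exists (u - v); first exact: subgroupB (chFs _) cu cv.
    rewrite bdF_additive; [|exact: chains_finsupp cu|exact: chains_finsupp cv].
    by split => //; rewrite (push_additive cu cv); exact: subgroupB hY Yu Yv.
  move=> X /r1[u uys [cu bu]]; exists u => //; split => //.
  by apply: sub_gen; left; rewrite /= map_f.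
have czy : chF p.+1 (z' - y) := subgroupB (chFs _) cz' cy.
(* The boundary of [z'] is [q + b], where [y] bounds [q] and [kap] bounds [b]. So this difference is
   a cycle of the free complex, hence a boundary; and [kap] vanishes in [M]. *)
have cZ : chF p.+1 (z' - y - kap) := subgroupB (chFs _) czy cFkap.
have bZ : bdF (z' - y - kap) = 0.
  rewrite bdF_additive; [|exact: chains_finsupp czy|exact: chains_finsupp cFkap].
  rewrite bdF_additive; [|exact: chains_finsupp cz'|exact: chains_finsupp cy].
  by rewrite by_ bE kE [q + b]addrC addrK subrr.
have H0 := additive_on0 (@subgroup_setT _) homotopy_additive.
have ZE := homotopyP cZ; rewrite bZ H0 addr0 in ZE.
have hcZ := homotopy_chains cZ.
have : push (z' - y - kap) = bdA (push (homotopy (z' - y - kap))).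
  by rewrite -[in LHS]ZE; exact: (push_boundary hcZ).
rewrite (push_additive czy cFkap) (push_additive cz' cy) pkap subr0 pz' => E.
rewrite -[z](subrK (push y)) E; apply: (subgroupD hY) => //.
by apply: BY; exact: push_chains.
Qed.

End DimensionShift.

(** The induction on [p] has to vary the module and its ambient group, since a shift passes to the
    relations inside a free module. These are finitely generated because the free module is
    noetherian. *)
Lemma homology_finitely_generated (V A : zmodType) (act : V -> A -> A) (l : seq V) (M : set A) p :
  let G := gen set0 [set` l] in
  is_action act -> submodule (action_ops act G) M ->
  (exists2 s : seq A, [set` s] `<=` M & M `<=` gen (action_ops act G) [set` s]) ->
  homology_fg act G M p.
Proof.
move=> G; have hG : subgroup G by exact: (gen_submodule _ _).1.
elim: p A act M => [|p IH] A act M hact hM [s sM Ms]; first exact: homology0_fg sM Ms.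
have hK := relations_submodule s hact hG.
apply: (homology_shift hact hG hM sM Ms); apply: IH => //; first exact: shift_is_action.
by apply: (noetherian_action (@shift_is_action V A s) (s := free_gens V s) hK) => x [].
Qed.

(** * Comparison with the bar complex of lists *)

Section ListChains.
Variables (R : realType) (n : nat).
Local Notation V := 'rV[R]_n.
Local Notation A := (V -> int).
Variables (G : set V) (M : set A).
Hypotheses (hG : subgroup G) (hM : submodule (action_ops (@tr_act R n) G) M).

Lemma tr_is_action : is_action (@tr_act R n).
Proof.
by split=> [g x y|x|g h x]; apply/funext => v; rewrite /tr_act ?fctE ?subr0 // opprD addrA.
Qed.

Lemma ev_evs (c : chain R n) t x : ev c t x = evs c t x.
Proof.
rewrite /ev /evs /lin fct_sumE fct_sumE big_mkcond /=; apply: eq_bigr => e _.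
by rewrite /single eq_sym; case: eqP.
Qed.

Lemma evs_cat (c c' : chain R n) : evs (c ++ c') = evs c + evs c'.
Proof. by rewrite /evs /lin big_cat. Qed.

Lemma evs_flatten (I : Type) (F : I -> chain R n) (r : seq I) :
  evs (flatten [seq F i | i <- r]) = \sum_(i <- r) evs (F i).
Proof.
elim: r => [|i r IH]; first by rewrite big_nil /evs /lin big_nil.
by rewrite big_cons -IH -evs_cat.
Qed.

Lemma evs_map (I : Type) (F : I -> seq V * A) (r : seq I) :
  evs [seq F i | i <- r] = \sum_(i <- r) single (F i).1 (F i).2.
Proof. by rewrite /evs /lin big_map. Qed.

(** Except for the face that merges [g] with the head of [s], the inner faces of g|s are faces of
    [s] with [g] in front; raising the index by one flips the sign. This matches the recursion of
    [inner]. *)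
Lemma bar_faceS p i g s (m : A) : (0 < i)%N ->
  single (bar_face p.+2 i.+1 (g :: s, m)).1 (bar_face p.+2 i.+1 (g :: s, m)).2 =
  - prefix1 g (single (bar_face p.+1 i (s, m)).1 (bar_face p.+1 i (s, m)).2).
Proof.
case: i => // i _; rewrite prefix1_single /bar_face /= !eqSS.
have E : (fun x => (-1) ^+ i.+2 * m x) = - (fun x => (-1) ^+ i.+1 * m x).
  by apply/funext => x; rewrite fctE exprS mulN1r mulNr.
by case: ifP => _; rewrite /= E (additive_onN (@subgroup_setT _) (@single_additive _ _ _)).
Qed.

Lemma bar_faces_inner g s (m : A) :
  \sum_(i <- iota 1 (size s).+1)
     single (bar_face (size s).+1 i (g :: s, m)).1 (bar_face (size s).+1 i (g :: s, m)).2
  = - inner (g :: s) m.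
Proof.
elim: s g => [|h s IH] g.
  rewrite big_seq1 /bar_face /= -(additive_onN (@subgroup_setT _) (@single_additive _ _ _)) //.
  by congr single; apply/funext => x; rewrite fctE mulN1r.
have -> : iota 1 (size (h :: s)).+1 = 1%N :: [seq (1 + i)%N | i <- iota 1 (size s).+1] by rewrite -(iotaDl 1 1).
rewrite inner_cons2 opprB big_cons big_map addrC; congr (_ + _).
  rewrite -[prefix1 _ _]opprK -(additive_onN (@subgroup_setT _) (@prefix1_additive _ _ g)) //.
  rewrite -IH; set r := iota 1 _.
  have : all (fun i => 0 < i)%N r by apply/allP => i; rewrite /r mem_iota => /andP[].
  elim: r => [|i r IHr] /=; first by rewrite !big_nil (additive_on0 (@subgroup_setT _) (@prefix1_additive _ _ g)) oppr0.
  move=> /andP[i0 /IHr E]; rewrite !big_cons (additive_onD (@subgroup_setT _) (@prefix1_additive _ _ g)) // opprD -E.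
  by congr (_ + _); rewrite add1n bar_faceS.
rewrite /bar_face /= -(additive_onN (@subgroup_setT _) (@single_additive _ _ _)) //.
by rewrite drop0; congr single; apply/funext => x; rewrite fctE mulN1r.
Qed.

Lemma evs_bd p (c : chain R n) : (forall e, e \in c -> size e.1 = p) ->
  evs (bd p c) = boundary (@tr_act R n) (evs c).
Proof.
move=> hc; rewrite /boundary (ext_evs (bar_single_additive tr_is_action)).
rewrite /lin; case: p hc => [|p] hc.
  rewrite /bd /evs /lin big_nil big1_seq // => -[s m] /= /hc /= /size0nil ->.
  by [].
rewrite /bd evs_flatten; apply: eq_big_seq => -[s m] /hc /=; case: s => [//|g s] [<-].
rewrite -[_ :: _]/[seq bar_face (size s).+1 i (g :: s, m) | i <- 0%N :: iota 1 (size s).+1].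
by rewrite evs_map big_cons bar_faces_inner /bar_face /= drop0.
Qed.

Lemma chain_chains p c : is_chain G M p c -> chains G M p (evs c).
Proof.
elim: c => [|[s m] c IH] hc.
  by rewrite /evs /lin big_nil; exact: subgroup0 (chains_subgroup hM p).
rewrite /evs /lin big_cons; apply: (subgroupD (chains_subgroup hM p)).
  by have [ss Gs Mm] := hc _ (mem_head _ _); exact: (chains_single hM).
by apply: IH => e ec; apply: hc; rewrite inE ec orbT.
Qed.

Lemma chains_chain p X : chains G M p X -> exists2 c, is_chain G M p c & evs c = X.
Proof.
move=> [fX hX]; have [l [_ E _]] := finsupp_support fX.
exists [seq (t, X t) | t <- l & X t != 0].
  move=> e /mapP[t]; rewrite mem_filter => /andP[Xt _] -> /=.
  by have [Mt ht] := hX t; have [st Gt] := ht Xt.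
rewrite evs_map [RHS]E big_filter big_mkcond; apply: eq_bigr => t _ /=.
by case: eqP => //= ->; rewrite single0.
Qed.

Lemma is_cycle_cycles p c : is_cycle G M p c -> cycles (@tr_act R n) G M p (evs c).
Proof.
move=> [hc bc]; split; first exact: chain_chains.
rewrite -(@evs_bd p); last by move=> e /hc[].
by apply/funext => t; apply/funext => x; rewrite -ev_evs bc.
Qed.

Lemma cycles_is_cycle p c : is_chain G M p c ->
  cycles (@tr_act R n) G M p (evs c) -> is_cycle G M p c.
Proof.
move=> hc [_ bc]; split => //; apply/funext => t; apply/funext => x.
by rewrite ev_evs evs_bd ?bc // => e /hc[].
Qed.

Lemma homology_fg_tensorQ p :
  homology_fg (@tr_act R n) G M p -> homology_tensorQ_findim G M p.
Proof.
move=> [s sZ Zs].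
have [|s' [r1 r2]] := @lift_seq _ _ (fun X c => is_chain G M p c /\ evs c = X) s.
  by move=> X /sZ[cX _]; have [c hc cE] := chains_chain cX; exists c.
pose zs (j : 'I_(size s')) := nth [::] s' j.
exists (size s'), zs; split.
  move=> j; have /r2[X Xs [hc cE]] : zs j \in s' by exact: mem_nth.
  by apply: cycles_is_cycle => //; rewrite cE; exact: sZ.
have hcs := chains_subgroup hM p.+1.
have bdB := boundary_additive tr_is_action.
move=> z /is_cycle_cycles /Zs zgen.
pose Q := [set X : seq V -> A | exists (cs : 'I_(size s') -> int) Y, chains G M p.+1 Y /\
  forall t x, X t x = \sum_j cs j * evs (zs j) t x + boundary (@tr_act R n) Y t x].
have hQ : subgroup Q.
  split.
    exists (fun=> 0), 0; split; first exact: subgroup0.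
    move=> t x; rewrite (additive_on0 (finsupp_subgroup _ _) bdB) big1 ?addr0 // => j _.
    by rewrite mul0r.
  move=> X X' [cs [Y [cY XE]]] [cs' [Y' [cY' XE']]].
  exists (fun j => cs j - cs' j), (Y - Y'); split; first exact: subgroupB.
  move=> t x; rewrite bdB; [|exact: chains_finsupp cY|exact: chains_finsupp cY'].
  rewrite !fctE XE XE' opprD addrACA; congr (_ + _).
  by rewrite -sumrB; apply: eq_bigr => j _; rewrite mulrBl.
have [cs [Y [cY zE]]] : Q (evs z).
  apply: (gen_min _ _ zgen); first by split.
  move=> X [/r1[c cs' [hc cE]]|[Y cY <-]]; last first.
    exists (fun=> 0), Y; split => // t x; rewrite big1 ?add0r // => j _; exact: mul0r.
  have lt : (index c s' < size s')%N by rewrite index_mem.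
  exists (fun j => (j == Ordinal lt)%:R), 0; split; first exact: subgroup0.
  move=> t x; rewrite (additive_on0 (finsupp_subgroup _ _) bdB) (bigD1 (Ordinal lt)) //= big1 ?addr0.
    by rewrite eqxx mul1r /zs /= nth_index // cE.
  by move=> j /negPf ->; rewrite mul0r.
have [b hb bE] := chains_chain cY.
(* The generation is integral, so the multiplier is 1. *)
exists 1, cs, b; split; [by []|split => // t x].
rewrite mul1r !ev_evs zE evs_bd ?bE; last by move=> e /hb[].
by congr (_ + _); apply: eq_bigr => j _; rewrite ev_evs.
Qed.

End ListChains.

(** * Facets of polytopes *)

Section Convexity.
Variables (R : realType) (n : nat).
Local Notation V := 'rV[R]_n.
Implicit Types (u v w x y : V).

Lemma dotvC u v : dotv u v = dotv v u.
Proof. by apply: eq_bigr => i _; rewrite mulrC. Qed.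
Lemma dotvDr u v w : dotv u (v + w) = dotv u v + dotv u w.
Proof. by rewrite -big_split; apply: eq_bigr => i _; rewrite mxE mulrDr. Qed.
Lemma dotvZr t u v : dotv u (t *: v) = t * dotv u v.
Proof. by rewrite /dotv mulr_sumr; apply: eq_bigr => i _; rewrite mxE mulrCA. Qed.
Lemma dotvNr u v : dotv u (- v) = - dotv u v.
Proof. by rewrite -scaleN1r dotvZr mulN1r. Qed.
Lemma dotvBr u v w : dotv u (v - w) = dotv u v - dotv u w.
Proof. by rewrite dotvDr dotvNr. Qed.
Lemma dotv0r u : dotv u 0 = 0.
Proof. by rewrite -(scale0r 0) dotvZr mul0r. Qed.
Lemma dotv_sumr (I : Type) (r : seq I) (P : pred I) u (F : I -> V) :
  dotv u (\sum_(i <- r | P i) F i) = \sum_(i <- r | P i) dotv u (F i).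
Proof. by elim/big_rec2: _ => [|i _ x _ <-]; rewrite ?dotv0r ?dotvDr. Qed.
Lemma dotvDl u v w : dotv (u + v) w = dotv u w + dotv v w.
Proof. by rewrite !(dotvC _ w) dotvDr. Qed.
Lemma dotvZl t u v : dotv (t *: u) v = t * dotv u v.
Proof. by rewrite !(dotvC _ v) dotvZr. Qed.
Lemma dotvNl u v : dotv (- u) v = - dotv u v.
Proof. by rewrite !(dotvC _ v) dotvNr. Qed.
Lemma dotvBl u v w : dotv (u - v) w = dotv u w - dotv v w.
Proof. by rewrite !(dotvC _ w) dotvBr. Qed.
Lemma dotv0l u : dotv 0 u = 0. Proof. by rewrite dotvC dotv0r. Qed.
Lemma dotvv_ge0 u : 0 <= dotv u u.
Proof. by apply: sumr_ge0 => i _; rewrite -expr2 sqr_ge0. Qed.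
Lemma dotvv_eq0 u : dotv u u = 0 -> u = 0.
Proof.
have pos i : xpredT i -> 0 <= u 0 i * u 0 i by rewrite -expr2 sqr_ge0.
move=> /(psumr_eq0P pos) h; apply/rowP => i; rewrite mxE; apply/eqP.
by rewrite -sqrf_eq0 expr2 h.
Qed.
Lemma dotvv_gt0 u : u != 0 -> 0 < dotv u u.
Proof.
by move=> nz; rewrite lt_neqAle dotvv_ge0 andbT eq_sym; apply: contra nz => /eqP/dotvv_eq0->.
Qed.

Lemma between k (x : 'I_k -> R) U : (forall i, x i < U) -> exists2 t, t < U & forall i, x i < t.
Proof.
move=> xU; pose m := \big[Num.max/U - 1]_(i < k) x i.
have mU : m < U.
  rewrite /m; elim/big_ind: _ => [|a b aU bU|i _] //; first by rewrite ltrBlDr ltrDl.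
  by rewrite gt_max aU.
exists ((m + U) / 2); first by lra.
by move=> i; apply: (@le_lt_trans _ _ m); [exact: le_bigmax|lra].
Qed.

Lemma upper k (x : 'I_k -> R) : exists t, 0 < t /\ forall i, x i < t.
Proof.
pose m := \big[Num.max/0]_(i < k) x i.
have m0 : 0 <= m by exact: bigmax_ge_id.
exists (m + 1); split; first by lra.
by move=> i; apply: (@le_lt_trans _ _ m); [exact: le_bigmax|lra].
Qed.

(* Gordan's alternative, by induction on the number of vectors (Fourier-Motzkin elimination
   of the first vector). *)
Lemma gordan k (w : 'I_k -> V) :
  (exists u, forall i, 0 < dotv u (w i)) \/
  (exists l : 'I_k -> R, [/\ forall i, 0 <= l i, 0 < \sum_i l i & \sum_i l i *: w i = 0]).
Proof.
elim: k w => [|k IH] w; first by left; exists 0 => -[].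
pose w0 := w ord0; pose w' i := w (lift ord0 i).
have ext_l (l0 : R) (l : 'I_k -> R) : 0 <= l0 -> (forall i, 0 <= l i) ->
    0 < l0 + \sum_i l i -> l0 *: w0 + \sum_i l i *: w' i = 0 ->
    exists l : 'I_k.+1 -> R, [/\ forall i, 0 <= l i, 0 < \sum_i l i & \sum_i l i *: w i = 0].
  move=> h0 h1 h2 h3; exists (fun i => oapp l l0 (unlift ord0 i)); split.
  - by move=> i; case: unliftP => [j _|_] //=.
  - by rewrite big_ord_recl unlift_none /=; under eq_bigr do rewrite liftK /=.
  - by rewrite big_ord_recl unlift_none /=; under eq_bigr do rewrite liftK /=.
have ext_u u : 0 < dotv u w0 -> (forall i, 0 < dotv u (w' i)) ->
    exists u, forall i, 0 < dotv u (w i).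
  by move=> h0 h1; exists u => i; case: (unliftP ord0 i) => [j ->|->]; [exact: (h1 j)|exact: h0].
have [[u uw]|[l [l0 ls lw]]] := IH w'; last first.
  by right; apply: (ext_l 0 l) => //; rewrite ?add0r // scale0r add0r.
pose c i := dotv u (w' i); pose c0 := dotv u w0.
have [c0p|c0n|c0z] := ltgtP 0 c0; first by left; exact: (ext_u u).
(* As [c0] is negative, these vectors are positive combinations of [w0] and [w' i], and they are
   orthogonal to [u]. If [v] is positive on them, the lower bounds that the [w' i] impose on [t] in
   [v + t *: u] stay below the upper bound imposed by [w0]. *)
- have [[v vw]|[l [l0 ls lw]]] := IH (fun i => c i *: w0 - c0 *: w' i); last first.
    right; apply: (ext_l (\sum_i l i * c i) (fun i => - c0 * l i)).
    + by apply: sumr_ge0 => i _; apply: mulr_ge0 => //; apply: ltW; exact: uw.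
    + by move=> i; apply: mulr_ge0 => //; rewrite oppr_ge0 ltW.
    + rewrite -mulr_sumr; apply: ltr_wpDl; last by apply: mulr_gt0 => //; rewrite oppr_gt0.
      by apply: sumr_ge0 => i _; apply: mulr_ge0 => //; apply: ltW; exact: uw.
    + rewrite -[RHS]lw scaler_suml -big_split /=; apply: eq_bigr => i _.
      by rewrite scalerBr !scalerA mulNr scaleNr [c0 * _]mulrC.
  have [i|t tU tx] := @between k (fun i => - dotv v (w' i) / c i) (dotv v w0 / (- c0)).
    have ci : 0 < c i := uw i; have := vw i; rewrite dotvBr !dotvZr => h.
    rewrite ltr_pdivrMr // mulrAC ltr_pdivlMr ?oppr_gt0 //; lra.
  left; apply: (ext_u (v + t *: u)).
    rewrite dotvDl dotvZl -/c0; move: tU; rewrite ltr_pdivlMr ?oppr_gt0 //; lra.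
  move=> i; have ci : 0 < c i := uw i; rewrite dotvDl dotvZl -/(c i).
  by move: (tx i); rewrite ltr_pdivrMr //; lra.
(* Here [u] is orthogonal to [w0]: adding a large multiple of [u] to [w0] keeps the product with
   [w0] equal to its squared norm and makes the others positive. *)
- have [w00|w0n] := eqVneq w0 0.
    right; apply: (ext_l 1 (fun=> 0)) => //; first by rewrite big1 ?addr0.
    by rewrite w00 scaler0 add0r big1 // => i _; rewrite scale0r.
  have [t [t0 tx]] := @upper k (fun i => - dotv w0 (w' i) / c i).
  left; apply: (ext_u (w0 + t *: u)).
    by rewrite dotvDl dotvZl -/c0 -c0z mulr0 addr0; exact: dotvv_gt0.
  move=> i; have ci : 0 < c i := uw i; rewrite dotvDl dotvZl -/(c i).
  by move: (tx i); rewrite ltr_pdivrMr //; lra.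
Qed.

(** In Gordan's alternative for the vectors [y - p i], a relation scaled to total weight 1 would put
    [y] in the hull. The bound 1 turns separating functionals into a polyhedron, ready for
    [vertex_exists]. *)
Lemma conv_separation k (p : 'I_k -> V) y : ~ conv p y ->
  exists u, forall i, 1 <= dotv u (y - p i).
Proof.
move=> ny; have [[u uw]|[l [l0 ls lw]]] := gordan (fun i => y - p i).
  have [t [t0 tx]] := @upper k (fun i => (dotv u (y - p i))^-1).
  exists (t *: u) => i; rewrite dotvZl; apply: ltW.
  by have := tx i; rewrite invf_plt ?posrE // => h; rewrite -ltr_pdivrMr // mul1r.
case: ny; exists (fun i => l i / \sum_i l i); split; last split.
- by move=> i; apply: divr_ge0 => //; exact: ltW.
- by rewrite -mulr_suml divff // gt_eqF.
- set S := \sum_i l i in ls *; apply: (@scalerI _ _ S); first by rewrite gt_eqF.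
  rewrite scaler_sumr scaler_suml; apply/eqP; rewrite -subr_eq0 -sumrB.
  apply/eqP; rewrite -[RHS]lw; apply: eq_bigr => i _; rewrite scalerBr scalerA mulrCA divff ?gt_eqF //.
  by rewrite mulr1.
Qed.

Lemma conv_le k (p : 'I_k -> V) u d x : (forall i, dotv u (p i) <= d) -> conv p x -> dotv u x <= d.
Proof.
move=> h [l [l0 [l1 ->]]]; rewrite dotv_sumr -[d]mul1r -l1 mulr_suml.
by apply: ler_sum => i _; rewrite dotvZr; apply: ler_wpM2l.
Qed.

Lemma conv_ge k (p : 'I_k -> V) u d x : (forall i, d <= dotv u (p i)) -> conv p x -> d <= dotv u x.
Proof.
move=> h cx; have := @conv_le k p (- u) (- d) x; rewrite dotvNl lerN2; apply => // i.
by rewrite dotvNl lerN2.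
Qed.

Lemma conv_point k (p : 'I_k -> V) i : conv p (p i).
Proof.
exists (fun j => (j == i)%:R); split; first by move=> j; rewrite ler0n.
split; first by rewrite (bigD1 i) //= big1 ?eqxx ?addr0 // => j /negPf ->.
by rewrite (bigD1 i) //= big1 ?eqxx ?addr0 ?scale1r // => j /negPf ->; rewrite scale0r.
Qed.

(* A feasible point with the most tight constraints works: otherwise move along the kernel of the
   tight constraints until a new one becomes tight. *)
Lemma vertex_exists k (w : 'I_k -> V) : (forall u, (forall i, dotv u (w i) = 0) -> u = 0) ->
  (exists u, forall i, 1 <= dotv u (w i)) ->
  exists2 u, (forall i, 1 <= dotv u (w i)) &
    forall v, (forall i, dotv u (w i) = 1 -> dotv v (w i) = 0) -> v = 0.
Proof.
move=> wfull [u0 hu0]; pose T u := [set i | dotv u (w i) == 1]%SET.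
have [m] := ubnP (k - #|T u0|)%N; elim: m u0 hu0 => // m IH u hu; rewrite ltnS => hm.
have [full|nfull] := pselect (forall v, (forall i, dotv u (w i) = 1 -> dotv v (w i) = 0) -> v = 0).
  by exists u.
have [v [vT [i0 vi0]]] : exists v, (forall i, dotv u (w i) = 1 -> dotv v (w i) = 0) /\
    exists i, dotv v (w i) < 0.
  have [v /not_implyP[vT vn]] : exists v, ~ ((forall i, dotv u (w i) = 1 -> dotv v (w i) = 0) -> v = 0).
    by apply/existsNP.
  have [i vi] : exists i, dotv v (w i) <> 0.
    by apply/existsNP => h; apply: vn; apply: wfull.
  have [lt|gt|//] := ltgtP (dotv v (w i)) 0; first by exists v; split => //; exists i.
  exists (- v); split; last by exists i; rewrite dotvNl oppr_lt0.
  by move=> j /vT; rewrite dotvNl => ->; rewrite oppr0.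
(* The ratio test of the simplex method: [r i] is the distance along [v] at which constraint [i]
   becomes tight, and the smallest one keeps [u'] feasible. *)
pose r i := (dotv u (w i) - 1) / - dotv v (w i).
case: (@arg_minP _ _ _ i0 (fun i => dotv v (w i) < 0) r vi0) => i1 vi1 rmin.
pose u' := u + r i1 *: v.
have r0 : 0 <= r i1 by apply: divr_ge0; rewrite ?subr_ge0 // oppr_ge0 ltW.
have hu' i : 1 <= dotv u' (w i).
  rewrite dotvDl dotvZl; have [ge|lt] := leP 0 (dotv v (w i)).
    by rewrite (le_trans (hu i)) // lerDl mulr_ge0.
  have := rmin i lt; rewrite {2}/r ler_pdivlMr ?oppr_gt0 //; lra.
apply: (IH u') => //.
have sub : T u \proper T u'.
  apply/properP; split.
    by apply/fintype.subsetP => i; rewrite !inE => /eqP ui; rewrite dotvDl dotvZl vT // mulr0 addr0 ui.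
  exists i1; last by rewrite inE; apply/negP => /eqP/vT vi1'; rewrite vi1' ltxx in vi1.
  rewrite inE dotvDl dotvZl /r invrN mulrN mulNr divfK; last by rewrite lt_eqF.
  by rewrite opprB addrC subrK.
have le : (#|T u'| <= k)%N by rewrite -[leqRHS]card_ord max_card.
by move: (proper_card sub) le hm; lia.
Qed.

Lemma tight_basis k (w : 'I_k -> V) u :
  (forall v, (forall i, dotv u (w i) = 1 -> dotv v (w i) = 0) -> v = 0) ->
  exists g : 'I_n -> 'I_k, [/\ forall j, dotv u (w (g j)) = 1,
    forall l : 'I_n -> R, \sum_j l j *: w (g j) = 0 -> forall j, l j = 0 &
    forall v, (forall j, dotv v (w (g j)) = 0) -> v = 0].
Proof.
(* Rows of constraints that are not tight are set to zero, so that a choice of independent rows can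
   only pick tight ones. *)
move=> full; pose W := \matrix_(i < k) (if dotv u (w i) == 1 then w i else 0).
have WE i : row i W = if dotv u (w i) == 1 then w i else 0 by rewrite rowK.
have mulW v i : (v *m W^T) 0 i = dotv v (row i W).
  by rewrite mxE; apply: eq_bigr => j _; rewrite !mxE.
have fullW : row_full W.
  rewrite /row_full -mxrank_tr; apply: inj_row_free => v vW; apply: full => i ui.
  by have := mulW v i; rewrite vW mxE WE ui eqxx.
pose g := fullrankfun fullW; pose B := rowsub g W.
have uB : row_free B by exact: fullrowsub_free.
have fB : row_full B by exact: fullrowsub_full.
have rowB j : row j B = row (g j) W by rewrite row_rowsub.
have gT j : dotv u (w (g j)) = 1.
  apply/eqP; apply: contraT => nT; have := rowB j; rewrite WE (negPf nT) rowE => /(canRL (mulmxK _)).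
  rewrite -row_free_unit => /(_ uB); rewrite mul0mx => /matrixP/(_ 0 j).
  by rewrite !mxE !eqxx => /eqP; rewrite oner_eq0.
have rowBw j : row j B = w (g j) by rewrite rowB WE gT eqxx.
exists g; split => //.
- move=> l l0 j; have : (\row_i l i) *m B = 0.
    by rewrite mulmx_sum_row -[RHS]l0; apply: eq_bigr => i _; rewrite rowBw mxE.
  rewrite -(mul0mx _ B) => /(row_free_inj uB) /matrixP/(_ 0 j).
  by rewrite !mxE.
- move=> v v0; have : B *m v^T = 0.
    apply/matrixP => j i; rewrite ord1 !mxE -[RHS](v0 j) -rowBw.
    by apply: eq_bigr => m _; rewrite !mxE mulrC.
  rewrite -(mulmx0 _ B) => /(row_full_inj fB) /(congr1 trmx).
  by rewrite trmxK trmx0.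
Qed.

Lemma interior_full (P : set V) x v d : interior_e P x -> (forall y, P y -> dotv v y = d) -> v = 0.
Proof.
move=> [e [e0 eP]] vP; apply/eqP; apply: contraT => nz; have vv := dotvv_gt0 nz.
(* Since s < (1 + s)^2, this [t] keeps [x + t *: v] inside the ball without a square root. *)
set s := dotv v v in vv; pose t := e / (1 + s).
have t0 : 0 < t by apply: divr_gt0 => //; lra.
have te : t * (1 + s) = e by rewrite /t divfK // gt_eqF //; lra.
have hx : dotv v x = d by apply: vP; apply: eP; rewrite /eball /= subrr dotv0r exprn_gt0.
have : dotv v (x + t *: v) = d.
  apply: vP; apply: eP; rewrite /eball /= addrC addKr dotvZl dotvZr -/s -te.
  by rewrite exprMn mulrA -expr2 ltr_pM2l ?exprn_gt0 //; nra.
by rewrite dotvDr dotvZr -/s hx; nra.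
Qed.

End Convexity.

Section Cells.
Variables (R : realType) (n : nat) (G : set 'rV[R]_n) (f : nat)
  (a : 'I_f -> 'rV[R]_n) (c : 'I_f -> R).
Local Notation V := 'rV[R]_n.
Local Notation C := (Cfam G a c).
Hypotheses (hG : subgroup G) (a0 : forall i, a i != 0).

Lemma translate_hyperplane (b : V) d g :
  translate (hyperplane b d) g = [set y | dotv b y = d + dotv b g].
Proof.
apply/seteqP; split => [_ [y /= yb <-]|y /= yb]; first by rewrite dotvDr yb.
by exists (y - g); rewrite ?subrK // /hyperplane /= dotvBr yb addrK.
Qed.

(* [(b, d)] stands for the affine form <b, .> - d, whose zero set belongs to the family. *)
Definition cform (j : V * R) : Prop := exists i g (s : bool),
  G g /\ j = ((-1) ^+ s *: a i, (-1) ^+ s * (c i + dotv (a i) g)).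

Lemma cform_in j : cform j -> C [set y | dotv j.1 y = j.2].
Proof.
move=> [i [g [s [Gg ->]]]]; exists i, g; split => //; rewrite translate_hyperplane.
by apply/seteqP; split => y /=; rewrite dotvZl; [move/(mulfI (negbT (signr_eq0 _ s)))|move=> ->].
Qed.

Definition pos (y : V) (j : V * R) : bool := j.2 < dotv j.1 y.
Definition cell (J : seq (V * R)) : V -> int := fun y => (all (pos y) J)%:R.

(** The functionals [u] with [1 <= dotv u (y - p i)] for all [i] form a polyhedron, which has a
    vertex because the polytope is full-dimensional. The points tight at such a vertex span a facet
    whose hyperplane separates [y] from the polytope, and the C-tope condition puts that hyperplane
    in the family. *)
Lemma facet_separation k (p : 'I_k -> V) y : (0 < n)%N ->
  Ctope C (conv p) -> (exists x, interior_e (conv p) x) -> ~ conv p y ->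
  exists j, [/\ cform j, forall i, j.2 <= dotv j.1 (p i), exists i, dotv j.1 (p i) = j.2 &
     dotv j.1 y < j.2].
Proof.
move=> n0 [_ [_ hF]] [x0 ix0] ny.
pose w i := y - p i.
have wfull u : (forall i, dotv u (w i) = 0) -> u = 0.
  move=> uw; apply: (@interior_full _ _ _ _ u (dotv u y) ix0) => z cz; apply/eqP; rewrite eq_le.
  by apply/andP; split; [apply: conv_le cz|apply: conv_ge cz] => i;
    have := uw i; rewrite /w dotvBr => /subr0_eq ->.
have [u uw utight] := vertex_exists wfull (conv_separation ny).
have [g [gT gfree gfull]] := tight_basis utight.
pose j0 : 'I_n := Ordinal n0.
have dotp v j : dotv v (p (g j)) = dotv v y - dotv v (w (g j)) by rewrite /w dotvBr opprB addrC subrK.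
pose d := dotv u y - 1.
have pd i : dotv u (p i) <= d by have := uw i; rewrite /w dotvBr /d; lra.
have pdT j : dotv u (p (g j)) = d by rewrite dotp gT.
pose F := conv p `&` hyperplane u d.
have Fp j : F (p (g j)) by split; [exact: conv_point|exact: pdT].
have fF : codim1_face (conv p) F.
  exists u, d; split.
    apply/eqP => u0; have := gT j0; rewrite u0 dotv0l => /eqP; rewrite eq_sym oner_eq0 //.
  split; first by move=> z cz; apply: conv_le cz.
  split=> //.
  have nE : n.-1.+1 = n by rewrite prednK.
  pose h (j : 'I_n.-1) : 'I_n := cast_ord nE (lift ord0 j).
  have h0 : cast_ord nE ord0 = j0 by apply: val_inj.
  exists (p (g j0)), (fun j => p (g (h j)) - p (g j0)); split; first exact: Fp.
  split; first by move=> j; rewrite addrC subrK; exact: Fp.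
  (* The differences of the [p (g _)] are differences of the [w (g _)], so an affine relation
     becomes a linear one once the total weight is placed on [j0]. *)
  move=> l l0; pose l' (j : 'I_n) := oapp (fun i => - l i) (\sum_i l i) (unlift ord0 (cast_ord (esym nE) j)).
  have l'h j : l' (h j) = - l j by rewrite /l' /h cast_ordK liftK.
  have l'0 : l' j0 = \sum_i l i by rewrite /l' -h0 cast_ordK unlift_none.
  have l'z : \sum_j l' j *: w (g j) = 0.
    rewrite (reindex (cast_ord nE)) /=; last first.
      by exists (cast_ord (esym nE)) => i _; rewrite ?cast_ordK ?cast_ordKV.
    rewrite big_ord_recl h0 l'0 scaler_suml -big_split /= -[RHS]l0; apply: eq_bigr => j _.
    by rewrite -/(h j) l'h scaleNr -scalerBr /w opprB addrC addrA subrK.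
  by move=> j; have := gfree _ l'z (h j); rewrite l'h => /eqP; rewrite oppr_eq0 => /eqP.
have [_ [[i [g' [Gg' ->]]] FH]] := hF _ fF.
rewrite translate_hyperplane in FH; set d' := c i + _ in FH.
(* On each basis vector [w (g j)], which is [y] minus a point of the facet, [a i] takes the value
   [e] and [u] the value 1. This forces [a i] to be [e *: u]. *)
pose e := dotv (a i) y - d'.
have ae : a i = e *: u.
  apply/eqP; rewrite -subr_eq0; apply/eqP; apply: gfull => j.
  have /= := FH _ (Fp j); rewrite dotp dotvBl dotvZl gT mulr1 /e; lra.
have e0 : e != 0 by apply: contra (a0 i) => /eqP e0; rewrite ae e0 scale0r.
have d'E : d' = e * d by have /= <- := FH _ (Fp j0); rewrite ae dotvZl pdT.
(* The sign makes the form a negative multiple of [u], so that the polytope lies on its nonnegative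
   side. *)
exists ((-1) ^+ (0 < e)%R *: a i, (-1) ^+ (0 < e)%R * d') => /=.
have sE : (-1) ^+ (0 < e)%R * e = - `|e|.
  case: (ltgtP 0 e) e0 => [e_gt0|e_lt0|<-]; rewrite ?eqxx //= => _.
    by rewrite expr1 mulN1r gtr0_norm.
  by rewrite expr0 mul1r ltr0_norm // opprK.
have ne : 0 < `|e| by rewrite normr_gt0.
rewrite d'E mulrA {2 3 4}ae scalerA sE; split.
- by exists i, g', (0 < e)%R; split => //; rewrite -/d' d'E mulrA sE.
- by move=> m; rewrite dotvZl !mulNr lerN2 ler_pM2l.
- by exists (g j0); rewrite dotvZl pdT.
- by rewrite dotvZl !mulNr ltrN2 ltr_pM2l // /d; lra.
Qed.

End Cells.

(** * Functions generated by half-spaces of the family *)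

Section Translation.
Variables (R : realType) (n : nat) (G : set 'rV[R]_n) (f : nat)
  (a : 'I_f -> 'rV[R]_n) (c : 'I_f -> R).
Local Notation V := 'rV[R]_n.
Local Notation C := (Cfam G a c).
Hypothesis hG : subgroup G.
Implicit Types (g x y : V) (P F : set V).

Definition shift_set g P : set V := [set y | P (y - g)].

Lemma shift_setK g P : shift_set (- g) (shift_set g P) = P.
Proof. by apply/seteqP; split => y; rewrite /shift_set /= opprK addrK. Qed.

Lemma eball_shift g x e y : eball (x + g) e y = eball x e (y - g).
Proof. by rewrite /eball /= opprD addrA addrAC. Qed.

Lemma interior_shift g P : interior_e (shift_set g P) = shift_set g (interior_e P).
Proof.
apply/seteqP; split => x [e [e0 eP]]; exists e; split => // y.
  by move=> yx; have := eP (y + g); rewrite /shift_set /= addrK; apply;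
    rewrite -[x](subrK g) eball_shift addrK.
by rewrite -{1}[x](subrK g) eball_shift => /eP.
Qed.

Lemma closure_shift g P : closure_e (shift_set g P) = shift_set g (closure_e P).
Proof.
apply/seteqP; split => x h e e0; have [y [Py ey]] := h e e0.
  by exists (y - g); split => //; rewrite -eball_shift subrK.
by exists (y + g); split; rewrite /shift_set /= ?addrK // -[x](subrK g) eball_shift addrK.
Qed.

Lemma conv_shift g k (p : 'I_k -> V) : shift_set g (conv p) = conv (fun i => p i + g).
Proof.
have E (l : 'I_k -> R) : \sum_i l i = 1 -> \sum_i l i *: (p i + g) = \sum_i l i *: p i + g.
  move=> l1; rewrite -[g in RHS]scale1r -l1 scaler_suml -big_split /=.
  by apply: eq_bigr => i _; rewrite scalerDr.
apply/seteqP; split => x [l [l0 [l1 xE]]]; exists l; split => //; split => //.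
  by rewrite E // -xE subrK.
by rewrite xE E // addrK.
Qed.

Lemma codim1_face_shift g P F : codim1_face P F -> codim1_face (shift_set g P) (shift_set g F).
Proof.
move=> [b [d [b0 [hP [-> [x0 [e [Fx0 [Fe le]]]]]]]]]; exists b, (d + dotv b g); split=> //.
split; first by move=> x /hP; rewrite dotvBr lerBlDr.
split.
  by apply/seteqP; split => x [Px hx]; split => //; move: hx; rewrite /hyperplane /= dotvBr;
    [move<-; rewrite subrK|move->; rewrite addrK].
exists (x0 + g), e; split; first by rewrite /shift_set /= addrK.
by split => // j; rewrite /shift_set /= addrAC addrK; exact: Fe.
Qed.

Lemma Cfam_shift g H : G g -> C H -> C (shift_set g H).
Proof.
move=> Gg [i [h [Gh ->]]]; exists i, (h + g); split; first exact: subgroupD.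
rewrite !translate_hyperplane; apply/seteqP; split => y; rewrite /shift_set /= dotvBr dotvDr; lra.
Qed.

Lemma Ctope_shift g P : G g -> Ctope C P -> Ctope C (shift_set g P).
Proof.
move=> Gg [[k [p ->]] [cl fc]]; split; first by exists k, (fun i => p i + g); rewrite conv_shift.
split; first by rewrite interior_shift closure_shift cl.
move=> F /(codim1_face_shift (- g)); rewrite shift_setK => /fc[H [CH FH]].
exists (shift_set g H); split; first exact: Cfam_shift.
by move=> x Fx; apply: FH; rewrite /shift_set /= opprK subrK.
Qed.

Lemma Vprime_shift g y : G g -> Vprime C (y - g) <-> Vprime C y.
Proof.
move=> Gg; split=> h [H CH Hy]; apply: h.
  exists (shift_set (- g) H); first by apply: Cfam_shift => //; exact: subgroupN.
  by rewrite /shift_set /= opprK subrK.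
by exists (shift_set g H); first exact: Cfam_shift.
Qed.

Lemma CV_submodule : submodule (action_ops (@tr_act R n) G) (CV C).
Proof.
split; first split; first exact: CV_zero.
  by move=> x y Cx Cy; apply: CV_add => //; exact: CV_opp.
move=> _ [g Gg <-] m; elim=> {m} [P hP||x y _ hx _ hy|x _ hx|x y _ hx _ hy].
- have -> : tr_act g (fun x => if `[< (P `&` Vprime C) x >] then 1 else 0 : int) =
    (fun x => if `[< (shift_set g P `&` Vprime C) x >] then 1 else 0).
    apply/funext => y; rewrite /tr_act; congr (if _ then _ else _).
    by apply: asbool_equiv_eq; split => -[Py /(Vprime_shift y Gg) Vy].
  exact/CV_gen/Ctope_shift.
- exact: CV_zero.
- exact: CV_add hx hy.
- exact: CV_opp hx.
- exact: CV_mul hx hy.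
Qed.

End Translation.

(** * Bounded support and difference operators *)

Section Periods.
Variables (R : realType) (n : nat).
Local Notation V := 'rV[R]_n.
Local Notation A := (V -> int).
Implicit Types (phi psi : A) (us : seq V).

Definition bounded phi := forall v, exists T, forall y, phi y != 0 -> dotv v y <= T.

Lemma bounded_subgroup : subgroup [set phi | bounded phi].
Proof.
split; first by move=> v; exists 0 => y; rewrite (_ : (0 : A) y = 0) // eqxx.
move=> x y bx by_ v; have [T hT] := bx v; have [T' hT'] := by_ v.
exists (Num.max T T') => z; rewrite fctE le_max => xyz.
have [xz|/hT ->//] := eqVneq (x z) 0.
by rewrite hT' ?orbT //; move: xyz; rewrite xz sub0r oppr_eq0.
Qed.

Lemma bounded_tr g phi : bounded phi -> bounded (tr_act g phi).
Proof.
move=> b v; have [T hT] := b v; exists (T + dotv v g) => y /hT.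
by rewrite dotvBr lerBlDr.
Qed.

Lemma bounded_mul phi psi : bounded phi -> bounded (fun x => phi x * psi x).
Proof.
by move=> b v; have [T hT] := b v; exists T => y; rewrite mulf_eq0 negb_or => /andP[/hT].
Qed.

Definition diff u phi : A := phi - tr_act u phi.
Definition diffs us phi : A := foldr diff phi us.

Lemma diff_additive u : additive_total (diff u).
Proof. by move=> x y _ _; apply/funext => z; rewrite /diff /tr_act !fctE opprD addrACA -opprD. Qed.

Lemma diffs_additive us : additive_total (diffs us).
Proof. by elim: us => [|u us IH] x y _ _ //=; rewrite IH // diff_additive. Qed.

Lemma diff_tr u g phi : diff u (tr_act g phi) = tr_act g (diff u phi).
Proof. by apply/funext => y; rewrite /diff /tr_act !fctE addrAC. Qed.

Lemma diffs_tr us g phi : diffs us (tr_act g phi) = tr_act g (diffs us phi).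
Proof. by elim: us => //= u us ->; rewrite diff_tr. Qed.

Lemma diffs_diff us u phi : diffs us (diff u phi) = diff u (diffs us phi).
Proof. by rewrite {1}/diff diffs_additive // diffs_tr. Qed.

Lemma diffs_diffs us us' phi : diffs us (diffs us' phi) = diffs us' (diffs us phi).
Proof. by elim: us' => //= u us' IH; rewrite diffs_diff IH. Qed.

(* This contains all finite sums of functions invariant under some nonzero translation. *)
Definition periodic : set A :=
  [set phi | exists us, (forall u, u \in us -> u != 0) /\ diffs us phi = 0].

Lemma diffs0 us : diffs us 0 = 0.
Proof. exact: additive_on0 (@subgroup_setT _) (@diffs_additive us). Qed.

Lemma periodic_submodule G : submodule (action_ops (@tr_act R n) G) periodic.
Proof.
split; first split; first by exists [::].
  move=> x y [us [us0 xus]] [vs [vs0 yvs]]; exists (us ++ vs); split.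
    by move=> u; rewrite mem_cat => /orP[/us0|/vs0].
  have cat phi : diffs (us ++ vs) phi = diffs us (diffs vs phi) by rewrite /diffs foldr_cat.
  by rewrite diffs_additive // !cat yvs diffs0 subr0 diffs_diffs xus diffs0.
move=> _ [g _ <-] x [us [us0 xus]]; exists us; split => //.
by rewrite diffs_tr xus.
Qed.

(** A nonzero value at [y] would recur at all [y - u *+ k], on which the functional of [- u] is
    unbounded. *)
Lemma bounded_diff_eq0 u phi : u != 0 -> bounded phi -> diff u phi = 0 -> phi = 0.
Proof.
move=> u0 b d0; have per y : phi y = phi (y - u).
  by have := congr1 (@^~ y) d0; rewrite /diff /tr_act !fctE => /subr0_eq.
have perk y k : phi y = phi (y - u *+ k).
  elim: k => [|k IH]; first by rewrite mulr0n subr0.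
  by rewrite IH per -addrA -opprD -mulrSr.
apply/funext => y; apply/eqP; apply: contraT => py.
have [T hT] := b (- u); have uu := dotvv_gt0 u0.
pose k := (Num.truncn ((T + dotv u y) / dotv u u)).+1.
have := hT (y - u *+ k); rewrite -perk => /(_ py).
rewrite dotvNl dotvBr -scaler_nat dotvZr opprB.
have : (T + dotv u y) / dotv u u < k%:R by exact: truncnS_gt.
rewrite ltr_pdivrMr //; lra.
Qed.

Lemma periodic_bounded phi : bounded phi -> periodic phi -> phi = 0.
Proof.
move=> b [us [us0 d]]; elim: us us0 d => //= u us IH us0 d.
apply: IH => [v vs|]; first by apply: us0; rewrite inE vs orbT.
apply: bounded_diff_eq0 d; first by apply: us0; rewrite mem_head.
elim: (us) => //= v vs bvs; exact: (subgroupB bounded_subgroup bvs (bounded_tr v bvs)).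
Qed.

End Periods.

(** * Reduction of products of half-space indicators *)

Section SignedCells.
Variables (R : realType) (n : nat).
Local Notation V := 'rV[R]_n.
Local Notation form := (V * R)%type.
Local Notation A := (V -> int).
Implicit Types (J : seq form) (S : seq (form * bool)).

Definition signed_cell S : A := fun y => (all (fun e => pos y e.1 == e.2) S)%:R.

Definition smaller J : set A :=
  gen set0 [set cell J' | J' in [set J' | (size J' < size J)%N /\ {subset J' <= J}]].

Lemma smaller_subgroup J : subgroup (smaller J).
Proof. exact: (gen_submodule _ _).1. Qed.

Definition times (j : form) (x : A) : A := fun y => (pos y j)%:R * x y.

Lemma times_cell j J : times j (cell J) = cell (j :: J).
Proof. by apply/funext => y; rewrite /times /cell /=; case: pos; rewrite ?mul1r ?mul0r. Qed.

Lemma times_additive j : additive_total (times j).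
Proof. by move=> x y _ _; apply/funext => z; rewrite /times !fctE mulrBr. Qed.

Lemma times_smaller j J x : smaller J x -> smaller (j :: J) (times j x).
Proof.
apply: (@gen_min _ _ _ [set x | smaller (j :: J) (times j x)]).
  have hs := smaller_subgroup (j :: J).
  split => //; split; first by rewrite /= (additive_on0 (@subgroup_setT _) (@times_additive j)); exact: subgroup0 hs.
  by move=> y z hy hz; rewrite /= times_additive //; exact: subgroupB hs hy hz.
move=> _ [J' [sJ' J'J] <-]; rewrite /= times_cell; apply: sub_gen; exists (j :: J') => //.
split => //= u; rewrite !inE => /orP[->//|/J'J ->]; exact: orbT.
Qed.

Lemma smaller_cons j J x : smaller J x -> smaller (j :: J) x.
Proof.
apply: gen_mono => _ [J' [sJ' J'J] <-]; exists J' => //; split; first exact: ltnW.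
by move=> u /J'J; rewrite inE => ->; rewrite orbT.
Qed.

Lemma cell_smaller_cons j J : smaller (j :: J) (cell J).
Proof.
by apply: sub_gen; exists J => //; split => //= u uJ; rewrite inE uJ orbT.
Qed.

(* Expand the product of the factors [pos] and [1 - pos]. *)
Lemma signed_cell_expand S : exists s : bool,
  smaller [seq e.1 | e <- S] (signed_cell S - cell [seq e.1 | e <- S] *~ (-1) ^+ s).
Proof.
elim: S => [|[j b] S [s IH]].
  exists false; rewrite (_ : _ - _ = 0); first exact: subgroup0 (gen_submodule _ _).1.
  by apply/funext => y; rewrite expr0 mulr1z subrr.
set J := [seq e.1 | e <- S] in IH *; rewrite /= -/J.
  have hs := smaller_subgroup (j :: J).
have tE z : times j (cell J *~ z) = cell (j :: J) *~ z.
  by rewrite (additive_totalMz _ _ (@times_additive j)) times_cell.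
have hT : smaller (j :: J) (times j (signed_cell S) - cell (j :: J) *~ (-1) ^+ s).
  by rewrite -tE -times_additive //; exact: times_smaller.
case: b.
  exists s; suff -> : signed_cell ((j, true) :: S) = times j (signed_cell S) by [].
  by apply/funext => y; rewrite /signed_cell /times /=; case: pos; rewrite ?mul1r ?mul0r.
exists (~~ s); have -> : signed_cell ((j, false) :: S) = signed_cell S - times j (signed_cell S).
  apply/funext => y; rewrite !fctE /signed_cell /times /=.
  by case: pos; rewrite ?mul1r ?mul0r ?subrr ?subr0.
have -> : (-1) ^+ (~~ s) = - (-1) ^+ s :> int by case: s {IH hT}; rewrite ?expr0 ?expr1 ?opprK.
have hX : smaller (j :: J) (signed_cell S).
  rewrite -[signed_cell S](subrK (cell J *~ (-1) ^+ s)).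
  apply: (subgroupD hs); first exact: smaller_cons.
  by apply: (subgroupMz _ hs); exact: cell_smaller_cons.
have -> : signed_cell S - times j (signed_cell S) - cell (j :: J) *~ - (-1) ^+ s =
    signed_cell S - (times j (signed_cell S) - cell (j :: J) *~ (-1) ^+ s).
  by rewrite mulrNz opprK opprB addrAC addrA.
exact: subgroupB hs hX hT.
Qed.

(* A linear relation between the normals makes some sign vector impossible, i.e. some product of
   factors [pos] and [1 - pos] vanishes; solve it for its leading term. *)
Lemma dependent_cell_smaller J (l : 'I_(size J) -> R) :
  \sum_i l i *: (tnth (in_tuple J) i).1 = 0 -> (exists i, l i != 0) -> smaller J (cell J).
Proof.
wlog [i0 li0] : l / exists i, 0 < l i.
  move=> wl l0 [i li]; have [gt|lt|z] := ltgtP 0 (l i).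
  - by apply: (wl l) => //; exists i.
  - apply: (wl (fun i => - l i)); first by exists i; rewrite oppr_gt0.
      by under eq_bigr do rewrite scaleNr; rewrite sumrN l0 oppr0.
    by exists i; rewrite oppr_eq0.
  - by rewrite -z eqxx in li.
move=> l0 _; pose b i := (tnth (in_tuple J) i).1; pose d i := (tnth (in_tuple J) i).2.
have sum0 y : \sum_i l i * (dotv (b i) y - d i) = - \sum_i l i * d i.
  have := congr1 (fun v => dotv v y) l0; rewrite dotv0l dotvC dotv_sumr => s0.
  under eq_bigr do rewrite mulrBr; rewrite sumrB -[RHS]add0r; congr (_ - _).
  by rewrite -[RHS]s0; apply: eq_bigr => i _; rewrite dotvZr dotvC.
(* If no point has the sign vector [sg], the corresponding signed product is zero, and its expansion
   solves for [cell J] up to sign. *)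
have key (sg : 'I_(size J) -> bool) : (forall y, ~ (forall i, (d i < dotv (b i) y) = sg i)) -> smaller J (cell J).
  move=> h; pose S := [seq (tnth (in_tuple J) i, sg i) | i <- enum 'I_(size J)].
  have SJ : [seq e.1 | e <- S] = J by rewrite -map_comp (map_tnth_enum (in_tuple J)).
  have S0 : signed_cell S = 0.
    apply/funext => y; rewrite /signed_cell; case: allP => // hS; case: (h y) => i.
    by apply/eqP; apply: (hS (tnth (in_tuple J) i, sg i)); apply: map_f; rewrite mem_enum.
  have hs := smaller_subgroup J.
  have [s] := signed_cell_expand S; rewrite S0 SJ sub0r => h1.
  have := subgroupN hs h1; rewrite opprK; case: (s); rewrite ?expr0 ?expr1 ?mulrNz mulr1z // => h2.
  by rewrite -[cell J]opprK; exact: subgroupN hs h2.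
(* The combination of the affine forms with weights [l] is constant. If the constant is at most 0,
   the sign pattern of [l] is impossible, since it would make the term of [i0] strictly positive;
   otherwise the opposite pattern is, since it makes all terms at most 0. *)
have [k0|k0] := leP 0 (\sum_i l i * d i).
  apply: (key (fun i => 0 < l i)) => y hy.
  have t_ge0 i : 0 <= l i * (dotv (b i) y - d i).
    have := hy i; case: (ltP 0 (l i)) => [lp h|ln /negbT]; first by rewrite mulr_ge0 ?ltW // subr_gt0.
    by rewrite -leNgt => h; rewrite mulr_le0 // subr_le0.
  have : 0 < \sum_i l i * (dotv (b i) y - d i).
    rewrite (bigD1 i0) //=; apply: ltr_pwDl; last exact: sumr_ge0.
    by apply: mulr_gt0 => //; rewrite subr_gt0 hy.
  by rewrite sum0 oppr_gt0 ltNge k0.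
apply: (key (fun i => ~~ (0 < l i))) => y hy.
have : \sum_i l i * (dotv (b i) y - d i) <= 0.
  apply: sumr_le0 => i _; have := hy i; case: (ltP 0 (l i)) => [lp /negbT|ln h] /=.
    by rewrite -leNgt => h; apply: mulr_ge0_le0; [exact: ltW|rewrite subr_le0].
  by apply: mulr_le0_ge0 => //; rewrite subr_ge0 ltW.
by rewrite sum0 oppr_le0 leNgt k0.
Qed.

End SignedCells.

(** The three fates of a cell: invariant under a translation along [u], reducible by a relation
    between its normals, or a simplicial cone with apex [x]. *)
Lemma independent_or_dependent (R : realType) (n : nat) (J : seq ('rV[R]_n * R)) :
  [\/ exists2 u, u != 0 & forall j, j \in J -> dotv u j.1 = 0,
      exists2 l : 'I_(size J) -> R, \sum_i l i *: (tnth (in_tuple J) i).1 = 0 & exists i, l i != 0 |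
      [/\ size J = n, exists x, forall j, j \in J -> dotv j.1 x = j.2 &
        forall v, (forall j, j \in J -> dotv j.1 v = 0) -> v = 0]].
Proof.
pose W := \matrix_(i < size J) (tnth (in_tuple J) i).1.
have mulW v i : (W *m v^T) i 0 = dotv (tnth (in_tuple J) i).1 v.
  by rewrite mxE; apply: eq_bigr => m _; rewrite !mxE.
have [free|nfree] := boolP (row_free W); last first.
  apply: Or32; move: nfree; rewrite -kermx_eq0 => /rowV0Pn[v /sub_kermxP vW vn0].
  exists (fun i => v 0 i).
    by rewrite -[RHS]vW mulmx_sum_row; apply: eq_bigr => i _; rewrite rowK.
  apply: contrapT => h; move/eqP: vn0; apply; apply/rowP => i; rewrite mxE; apply/eqP.
  by apply: contraT => vi; case: h; exists i.
have inJ j : j \in J -> exists i, j = tnth (in_tuple J) i.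
  by move=> jJ; apply/tnthP.
have [full|nfull] := boolP (row_full W); last first.
  apply: Or31; move: nfull; rewrite /row_full -mxrank_tr -[_ == n]/(row_free W^T) -kermx_eq0.
  move=> /rowV0Pn[v /sub_kermxP vW vn0]; exists v => // j /inJ[i ->].
  by rewrite dotvC -mulW -[W]trmxK -trmx_mul vW !mxE.
apply: Or33; have sJ : size J = n by rewrite -(eqP free) (eqP full).
have inj v : (forall j, j \in J -> dotv j.1 v = 0) -> v = 0.
  move=> h; have : W *m v^T = W *m 0.
    by apply/matrixP => i j; rewrite ord1 mulW mulmx0 mxE h // mem_tnth.
  by move/(row_full_inj full)/(congr1 trmx); rewrite trmxK trmx0.
split=> //; pose d := \col_i (tnth (in_tuple J) i).2.
have /submxP[D dD] : (d^T <= W^T)%MS by apply: submx_full; rewrite /row_full mxrank_tr (eqP free).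
exists D => j /inJ[i ->]; rewrite -mulW.
by rewrite -[W *m _]trmxK trmx_mul trmxK -dD trmxK mxE.
Qed.

(** * From C-topes to cells, and generators for the cells *)

Section CellModule.
Variables (R : realType) (n : nat) (G : set 'rV[R]_n) (f : nat)
  (a : 'I_f -> 'rV[R]_n) (c : 'I_f -> R).
Local Notation V := 'rV[R]_n.
Local Notation C := (Cfam G a c).
Local Notation A := (V -> int).
Local Notation O := (action_ops (@tr_act R n) G).
Hypotheses (hG : subgroup G) (a0 : forall i, a i != 0).

Definition cforms (J : seq (V * R)) := forall j, j \in J -> cform G a c j.
Definition cells : set A := gen set0 [set cell J | J in cforms].

Lemma cells_subgroup : subgroup cells. Proof. exact: (gen_submodule _ _).1. Qed.

Lemma cells_mul x y : cells x -> cells y -> cells (fun t => x t * y t).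
Proof.
move=> hx hy; have hc := cells_subgroup.
have mulB (z u v : A) : (fun t => (u - v) t * z t) = (fun t => u t * z t) - (fun t => v t * z t).
  by apply/funext => t; rewrite !fctE mulrBl.
have mul0 (z : A) : (fun t => (0 : A) t * z t) = 0 by apply/funext => t; rewrite mul0r.
apply: (@gen_min _ _ _ [set x | cells (fun t => x t * y t)]) hx.
  split => //; split; first by rewrite /= mul0; exact: subgroup0 hc.
  by move=> u v hu hv; rewrite /= mulB; exact: subgroupB hc hu hv.
move=> _ [J hJ <-] /=; have mulC (u v : A) : (fun t => u t * v t) = (fun t => v t * u t).
  by apply/funext => t; rewrite mulrC.
rewrite mulC; apply: (@gen_min _ _ _ [set y | cells (fun t => y t * cell J t)]) hy.
  split => //; split; first by rewrite /= mul0; exact: subgroup0 hc.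
  by move=> u v hu hv; rewrite /= mulB; exact: subgroupB hc hu hv.
move=> _ [J' hJ' <-] /=; apply: sub_gen; exists (J' ++ J).
  by move=> j; rewrite mem_cat => /orP[/hJ'|/hJ].
by apply/funext => t; rewrite /cell all_cat; do 2 case: all; rewrite ?mul1r ?mul0r.
Qed.

Lemma cform_tr g j : G g -> cform G a c j -> cform G a c (j.1, j.2 + dotv j.1 g).
Proof.
move=> Gg [i [h [s [Gh ->]]]]; exists i, (h + g), s; split; first exact: subgroupD.
by rewrite /= dotvZl dotvDr -mulrDr addrA.
Qed.

Lemma tr_cell (g : V) (J : seq (V * R)) : tr_act g (cell J) = cell [seq (j.1, j.2 + dotv j.1 g) | j <- J].
Proof.
apply/funext => y; rewrite /tr_act /cell all_map; congr (_%:R); congr nat_of_bool.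
by apply: eq_all => j; rewrite /pos /= dotvBr ltrBrDr.
Qed.

Lemma cells_submodule : submodule O cells.
Proof.
have hc := cells_subgroup; split => // _ [g Gg <-] x.
apply: (@gen_min _ _ _ [set x | cells (tr_act g x)]).
  split => //; split; first by rewrite /= (_ : tr_act g 0 = 0) //; exact: subgroup0 hc.
  move=> u v hu hv; rewrite /= (actB (@tr_is_action R n)); exact: subgroupB hc hu hv.
move=> _ [J hJ <-]; rewrite /= tr_cell; apply: sub_gen; eexists; last by [].
by move=> _ /mapP[j /hJ hj ->]; exact: cform_tr.
Qed.

Definition bounded_cells : set A := [set x | cells x /\ bounded x].

Lemma bounded_cells_submodule : submodule O bounded_cells.
Proof.
have hc := cells_submodule; have hb := bounded_subgroup R n; split; first split.
- by split; [exact: subgroup0 hc.1|exact: subgroup0 hb].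
- by move=> x y [cx bx] [cy by_]; split; [exact: subgroupB hc.1 cx cy|exact: subgroupB hb bx by_].
- move=> _ [g Gg <-] x [cx bx]; split; last exact: bounded_tr.
  by apply: hc.2 => //; exists g.
Qed.

Definition restrict (x : A) : A := fun y => if `[< Vprime C y >] then x y else 0.

(** The cell uses the supporting half-spaces with normals [a i] and [- a i] whose hyperplanes belong
    to the family. By [facet_separation] they cut out [P], and on V' weak and strict inequalities
    agree. *)
Lemma Ctope_cell P : Ctope C P -> exists2 x, bounded_cells x &
  (fun y => if `[< (P `&` Vprime C) y >] then 1 else 0) = restrict x.
Proof.
move=> ctP; have [[k [p PE]] _] := ctP.
have [[x0 Px0]|emp] := pselect (exists x, P x); last first.
  exists 0; first by split; [exact: subgroup0 cells_subgroup|exact: subgroup0 (bounded_subgroup R n)].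
  apply/funext => y; rewrite /restrict asboolF => [|[Py _]]; first by case: asboolP.
  by apply: emp; exists y.
have [i0 _] : exists i0 : 'I_k, True.
  move: Px0; rewrite PE => -[l [_ [l1 _]]]; case: (k) l l1 => [l|m _ _]; last by exists ord0.
  by rewrite big_ord0 => /eqP; rewrite eq_sym oner_eq0.
have iP : exists x, interior_e P x.
  have [_ [cl _]] := ctP; have := Px0; rewrite -[X in X x0]cl => /(_ 1 ltr01)[x [ix _]].
  by exists x.
pose m (b : V) := \big[Num.min/dotv b (p i0)]_i dotv b (p i).
pose bs := [seq ((-1) ^+ (s : bool) *: a i) | i <- enum 'I_f, s <- [:: true; false]].
pose J := [seq j <- [seq (b, m b) | b <- bs] | `[< cform G a c j >]].
have hJ : cforms J by move=> j; rewrite mem_filter => /andP[/asboolP].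
have mP b y : P y -> m b <= dotv b y.
  by rewrite PE => cy; apply: conv_ge cy => i; exact: bigmin_le.
have PJ y : P y -> Vprime C y -> all (pos y) J.
  move=> Py Vy; apply/allP => j jJ; have hj := hJ _ jJ; move: jJ.
  rewrite mem_filter => /andP[_ /mapP[b _ jE]]; rewrite /pos lt_neqAle.
  apply/andP; split; last by rewrite jE; exact: mP.
  by apply/negP => /eqP E; apply: Vy; exists [set y | dotv j.1 y = j.2]; [exact: cform_in|].
have JP y : all (pos y) J -> P y.
  move=> aJ; apply: contrapT; rewrite PE => ny.
  have [n0|nn0] := posnP n.
    apply: ny; rewrite -PE; suff -> : y = x0 by [].
    by apply/rowP => -[i hi]; exfalso; rewrite n0 in hi.
  rewrite PE in ctP iP.
  have [j [hj jp [i ji] jy]] := facet_separation a0 nn0 ctP iP ny.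
  (* The form bounds the vertices from below and attains its constant at one of them, so it is the
     supporting form recorded in [J]. *)
  have jm : j.2 = m j.1.
    apply/eqP; rewrite eq_le; apply/andP; split.
      by rewrite /m; elim/big_ind: _ => // u v hu hv; rewrite le_min hu.
    by rewrite -ji; exact: bigmin_le.
  have jJ : j \in J.
    rewrite mem_filter asboolT //=; apply/mapP; exists j.1; last by rewrite -jm; case: (j).
    have [l [g [s [_ ->]]]] := hj; apply/allpairsP; exists (l, s) => /=.
    by rewrite mem_enum; split => //; case: (s).
  by have := allP aJ j jJ; rewrite /pos ltNge (ltW jy).
exists (cell J); first split.
- by apply: sub_gen; exists J.
- move=> v; have [T [_ hT]] := @upper _ _ (fun i => dotv v (p i)).
  exists T => y; rewrite /cell; case: (boolP (all _ _)) => [/JP|_]; last by rewrite eqxx.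
  by rewrite PE => cy _; apply: conv_le cy => i; apply: ltW.
- apply/funext => y; rewrite /restrict /cell.
  case: (asboolP (Vprime C y)) => Vy; last by rewrite asboolF // => -[].
  case: (boolP (all _ _)) => [/JP Py|nJ]; first by rewrite asboolT.
  by rewrite asboolF // => -[Py _]; rewrite PJ in nJ.
Qed.

Lemma CV_restrict x : CV C x -> exists2 y, bounded_cells y & x = restrict y.
Proof.
have hb := bounded_cells_submodule.
elim=> {x} [P /Ctope_cell//||x y _ [x' bx ->] _ [y' by_ ->]|x _ [x' bx ->]|x y _ [x' bx ->] _ [y' by_ ->]].
- by exists 0; [exact: subgroup0 hb.1|apply/funext => y; rewrite /restrict; case: ifP].
- exists (x' + y'); first exact: subgroupD hb.1 bx by_.
  by apply/funext => t; rewrite /restrict !fctE; case: ifP; rewrite ?addr0.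
- exists (- x'); first exact: subgroupN hb.1 bx.
  by apply/funext => t; rewrite /restrict !fctE; case: ifP; rewrite ?oppr0.
- exists (fun t => x' t * y' t).
    split; first by apply: cells_mul; [case: bx|case: by_].
    by apply: bounded_mul; case: bx.
  by apply/funext => t; rewrite /restrict; case: ifP; rewrite ?mul0r.
Qed.

Fixpoint words (T : Type) (bs : seq T) m : seq (seq T) :=
  if m is m'.+1 then [seq b :: w | b <- bs, w <- words bs m'] else [:: [::]].

Lemma mem_words (T : eqType) (bs w : seq T) : {subset w <= bs} -> w \in words bs (size w).
Proof.
elim: w => [|b w IH] h //=; apply/allpairsP; exists (b, w); split => //=.
  by apply: h; rewrite mem_head.
by apply: IH => x xw; apply: h; rewrite inE xw orbT.
Qed.

(** All words of length [n] in the normals [a i] and [- a i] are taken, degenerate ones included,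
    since only finiteness of the list matters. *)
Definition vertex_cells (xs : seq V) : seq A :=
  [seq cell [seq (b, dotv b e.1) | b <- e.2] | e <- [seq (x, w) | x <- xs,
    w <- words [seq ((-1) ^+ (s : bool) *: a i) | i <- enum 'I_f, s <- [:: true; false]] n]].

Hypothesis Ofin : finite_set [set gorbit G x | x in singular_point C].

Lemma orbit_representatives : exists xs : seq V, forall x, singular_point C x ->
  exists2 x', x' \in xs & G (x - x').
Proof.
have [s sE] := (finite_seqP _).1 Ofin.
exists [seq xget 0 [set x | gorbit G x = B] | B <- s] => x sx.
have xs : gorbit G x \in s by have : [set` s] (gorbit G x) by rewrite -sE; exists x.
exists (xget 0 [set y | gorbit G y = gorbit G x]).
  by apply/mapP; exists (gorbit G x).
have : gorbit G (xget 0 [set y | gorbit G y = gorbit G x]) = gorbit G x.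
  by apply: (@xgetPex _ 0 [set y | gorbit G y = gorbit G x]); exists x.
set y := xget _ _ => yx; have : gorbit G x x by exists 0; rewrite ?addr0 //; exact: subgroup0.
by rewrite -yx => -[g Gg <-]; rewrite addrC addKr.
Qed.

Lemma cell_decomposition : exists s : seq A,
  cells `<=` sumset (gen O [set` s]) (@periodic R n).
Proof.
have [xs hxs] := orbit_representatives.
(* The extra apex 0 serves dimension 0, where by definition no point is singular. *)
exists (vertex_cells (0 :: xs)); set B := gen O _.
have hB : submodule O B by exact: gen_submodule.
have hL := @periodic_submodule R n G.
have hS := sumset_submodule (action_addops (@tr_is_action R n) (G := G)) hB hL.
have sB x : B x -> sumset B (@periodic R n) x.
  by move=> Bx; exists x, 0; rewrite addr0; split => //; exact: subgroup0 hL.1.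
apply: gen_min; first by split; [exact: hS.1|].
move=> _ [J + <-]; have [m] := ubnP (size J); elim: m J => // m IH J; rewrite ltnS => sJ hJ.
have [[u u0 uJ]|[l l0 ln0]|[sJn [x xJ] Jinj]] := independent_or_dependent J.
- exists 0, (cell J); rewrite add0r; split => //; first exact: subgroup0 hB.1.
  exists [:: u]; split; first by move=> v; rewrite inE => /eqP ->.
  rewrite /= /diff tr_cell; apply/eqP; rewrite subr_eq0; apply/eqP; congr cell.
  rewrite -[LHS]map_id; apply/eq_in_map => j jJ.
  by rewrite [dotv j.1 u]dotvC uJ // addr0; case: (j).
- have := dependent_cell_smaller l0 ln0; apply: gen_min; first by split; [exact: hS.1|].
  move=> _ [J' [sJ' J'J] <-]; apply: IH; first exact: leq_trans sJ' sJ.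
  by move=> j /J'J /hJ.
- apply: sB; have [x' [x'xs Gx]] : exists x', x' \in 0 :: xs /\ G (x - x').
    have [n0|nn0] := posnP n.
      exists 0; rewrite mem_head; split => //; rewrite subr0.
      suff -> : x = 0 by exact: subgroup0.
      by apply/rowP => -[i hi]; exfalso; rewrite n0 in hi.
    (* The apex is the only common point of the hyperplanes of [J], because a vector orthogonal to
       all their normals is zero. *)
    have /hxs[x' x'xs Gx] : singular_point C x.
      split => //; exists [set [set y | dotv j.1 y = j.2] | j in [set` J]]; split.
        by move=> _ [j /hJ hj <-]; exact: cform_in.
      apply/seteqP; split => [y hy|y -> _ [j jJ <-]]; last exact: xJ.
      apply/eqP; rewrite -subr_eq0; apply/eqP; apply: Jinj => j jJ.
      have /= yj := hy _ (ex_intro2 _ _ j jJ erefl).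
      by rewrite dotvBr yj xJ // subrr.
    by exists x'; rewrite inE x'xs orbT.
  have -> : cell J = tr_act (x - x') (cell [seq (b, dotv b x') | b <- [seq j.1 | j <- J]]).
    rewrite tr_cell -!map_comp; congr cell; rewrite -[LHS]map_id; apply/eq_in_map => j jJ /=.
    by rewrite dotvBr addrC subrK xJ //; case: (j).
  apply: hB.2; first by exists (x - x').
  have inB z : z \in vertex_cells (0 :: xs) -> B z by move=> zv; exact: sub_gen.
  apply: inB; apply/mapP; exists (x', [seq j.1 | j <- J]) => //.
  apply: (allpairs_f (fun x w => (x, w))) => //.
  rewrite -[n in words _ n]sJn -(size_map fst J); apply: mem_words => _ /mapP[j /hJ[i [g [s [_ ->]]]] ->].
  by apply/allpairsP; exists (i, s) => /=; rewrite mem_enum; split => //; case: (s).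
Qed.

End CellModule.

(** The bounded cell functions live on all of V; they are noetherian modulo periodic functions, into
    which quotient they embed. Restriction to V' commutes with translations by [G], because V' is
    invariant. *)
Lemma CV_noetherian (R : realType) (n : nat) (l : seq 'rV[R]_n) (f : nat)
    (a : 'I_f -> 'rV[R]_n) (c : 'I_f -> R) :
  let G := gen set0 [set` l] in (forall i, a i != 0) ->
  finite_set [set gorbit G x | x in singular_point (Cfam G a c)] ->
  noetherian (action_ops (@tr_act R n) G) (CV (Cfam G a c)).
Proof.
move=> G a0 fin; have hG : subgroup G by exact: (gen_submodule _ _).1.
have addO := action_addops (@tr_is_action R n) (G := G).
have [s cs] := cell_decomposition hG fin.
have hb := @bounded_cells_submodule R n G f a c hG.
have nB : noetherian (action_ops (@tr_act R n) G) (bounded_cells G a c).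
  apply: (noetherian_transfer addO (gen_submodule _ [set` s]) hb (@periodic_submodule R n G)).
  - by move=> x [/cs].
  - by move=> x [_ bx]; exact: periodic_bounded.
  - exact: noetherian_action (@tr_is_action R n) _ _.
apply: (@noetherian_sub _ _ _ (restrict G a c @` bounded_cells G a c)).
  by move=> x /(CV_restrict hG a0)[y by_ ->]; exists y.
apply: noetherian_image nB => //.
  by move=> x y; apply/funext => t; rewrite /restrict !fctE; case: ifP; rewrite ?subrr.
move=> _ [g Gg <-]; exists (tr_act g); first by exists g.
move=> x; apply/funext => t; rewrite /restrict /tr_act; congr (if _ then _ else _).
by apply: asbool_equiv_eq; split => /(Vprime_shift _ _ hG t Gg).
Qed.

Lemma zspan_gen (R : realType) (n k : nat) (b : 'I_k -> 'rV[R]_n) :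
  zspan b = gen set0 [set` codom b].
Proof.
apply/seteqP; split.
  move=> _ [z ->]; have hg := gen_submodule set0 [set` codom b].
  apply: subgroup_sum hg.1 _ => i _; apply: subgroupMz hg.1 _.
  by apply: sub_gen; exact: codom_f.
apply: gen_min.
  split => //; split; first by exists (fun=> 0); rewrite big1 // => i _; rewrite mulr0z.
  move=> _ _ [z ->] [z' ->]; exists (fun i => z i - z' i).
  by rewrite -sumrB; apply: eq_bigr => i _; rewrite mulrzBr.
move=> _ /codomP[i ->]; exists (fun j => (j == i)%:R).
rewrite (bigD1 i) //= eqxx mulr1z big1 ?addr0 // => j /negPf ->; exact: mulr0z.
Qed.

Theorem theoremV2p4 (R : realType) (n : nat) (G : set 'rV[R]_n)
  (f : nat) (a : 'I_f -> 'rV[R]_n) (c : 'I_f -> R) :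
  free_abelian_finite_rank G ->
  dense_e G ->
  (forall i, a i != 0) ->
  spans a ->
  finite_set [set gorbit G x | x in singular_point (Cfam G a c)] ->
  forall p : nat, homology_tensorQ_findim G (CV (Cfam G a c)) p.
Proof.
move=> [k [b [_ ->]]] _ a0 _; rewrite zspan_gen => fin p.
set G' := gen _ _ in fin *; have hG : subgroup G' by exact: (gen_submodule _ _).1.
have hM := @CV_submodule R n G' f a c hG.
apply: (homology_fg_tensorQ hM); apply: homology_finitely_generated => //.
  exact: tr_is_action.
(* Noetherianity applied to the largest submodule, [CV] itself, gives its finite generation. *)
exact: (CV_noetherian a0 fin hM).
Qed.
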